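(* Consider the coupled semi-explicit index-1 DAE initial value problem on $\mathcal I=[0,T]$ $$y_1'=f_1(y_1,y_2,z_1,z_2),\quad 0=g_1(y_1,y_2,z_1,z_2),\quad y_2'=f_2(y_1,y_2,z_1,z_2),\quad 0=g_2(y_1,y_2,z_1,z_2),$$ $$y(0)=y_0=(y_{1,0},y_{2,0})\in\mathbb R^{n_y},\qquad z(0)=z_0=(z_{1,0},z_{2,0})\in\mathbb R^{n_z},$$ where $y=(y_1,y_2)$ and $z=(z_1,z_2)$. Assume that it has a unique solution $(y,z):[0,T]\to\mathbb R^{n_y}\times\mathbb R^{n_z}$, that $f_1,f_2,g_1,g_2$ are sufficiently differentiable in a neighbourhood of the solution, and that the Jacobian $\partial(g_1,g_2)/\partial(z_1,z_2)$ is regular (invertible) in a neighbourhood of the solution. Consider the two subsystems $$\text{(S1)}\quad y_1'=f_1(y_1,y_2,z_1,z_2),\quad 0=g_1(y_1,y_2,z_1,z_2),\quad y_2'=0,\quad 0=g_2(y_1,y_2,z_1,z_2),$$ $$\text{(S2)}\quad y_1'=0,\quad 0=g_1(y_1,y_2,z_1,z_2),\quad y_2'=f_2(y_1,y_2,z_1,z_2),\quad 0=g_2(y_1,y_2,z_1,z_2).$$ Then: (i) Solving (S1) and (S2) sequentially (Lie-Trotter splitting) on the subintervals $[t_n,t_{n+1}]$ of $\mathcal I$, with time integration methods that are convergent of order at least one, yields a method for the overall DAE that is convergent of first order on $\mathcal I$. (ii) Applying Strang splitting to (S1) and (S2), with time integration schemes of order at least two, yields a method for the overall DAE that is convergent of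 second order on $\mathcal I$.
   Context: $T>0$ is finite. Let $t_n=nh$, $n=0,\dots,N$, $h=T/N$. Reduction to ODEs: by the regularity of $\partial(g_1,g_2)/\partial(z_1,z_2)$ and the implicit function theorem, near the solution the constraints $g_1=g_2=0$ are equivalent to $(z_1,z_2)=\varphi(y_1,y_2)$ for a continuously differentiable function $\varphi$. Both subsystems contain both algebraic constraints, so (S1) is equivalent to the ODE $y_1'=f_1(y_1,y_2,\varphi(y_1,y_2))$, $y_2'=0$, and (S2) is equivalent to the ODE $y_1'=0$, $y_2'=f_2(y_1,y_2,\varphi(y_1,y_2))$, each together with $z=\varphi(y)$. Lie-Trotter splitting: starting from the approximation at $t_n$, solve (S1) over a time step of length $h$, then solve (S2) over a time step of length $h$ with initial value equal to the end value of the first solve; the result is the approximation at $t_{n+1}$. Strang splitting: starting from the approximation at $t_n$, solve (S1) over a time step of length $h/2$, then (S2) over a time step of length $h$, then (S1) over a time step of length $h/2$, each solve being initialized with the end value of the previous one; the result is the approximation at $t_{n+1}$. In both cases each sub-solve is performed by a numerical one-step time integration method applied to the subsystem (with the algebraic variables determined by the constraints, $z=\varphi(y)$). Such a method has order $p$ in the usual sense for one-step methods on sufficiently smooth problems: applied to the subsystem from initial data near the solution, its error over one step of length $h$ is $O(h^{p+1})$ uniformly in the initial data. The overall method, producing approximations $(y_n,z_n)$ with $(y_0,z_0)$ the given initial values, is convergent of order $p$ on $\mathcal I$ if there are $C,h_0>0$ with $\max_{0\le n\le N}\left(\|y_n-y(t_n)\|+\|z_n-z(t_n)\|\right)\le C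 h^p$ for all $h=T/N\le h_0$. *)

(* Defs.v *)
From HB Require Import structures.
From mathcomp Require Import all_boot all_order all_algebra.
From mathcomp Require Import all_classical all_reals all_analysis.

Set Implicit Arguments.
Unset Strict Implicit.
Unset Printing Implicit Defensive.

Import Order.TTheory GRing.Theory Num.Theory.
Import numFieldNormedType.Exports.

Local Open Scope classical_set_scope.
Local Open Scope ring_scope.

(* A state is the pair (y, z) with y = (y1, y2) differential and z = (z1, z2)
   algebraic; norms are the library's (maximum) norms. *)
Notation dae_state R ny1 ny2 nz1 nz2 :=
  (('rV[R]_ny1 * 'rV[R]_ny2) * ('rV[R]_nz1 * 'rV[R]_nz2))%type.

(* In finite dimension this is the usual class C^k on the open set U. *)
Fixpoint of_class_C (R : realType) (V W : normedModType R) (k : nat)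
    (U : set V) (f : V -> W) : Prop :=
  match k with
  | 0%N => forall p, U p -> {for p, continuous f}
  | k'.+1 => (forall p, U p -> differentiable f p) /\
             (forall v, of_class_C k' U ('D_v f))
  end.

(* u'(t) = l for u regarded as a function on A only: one-sided at the
   endpoints when A is a segment. *)
Definition is_derive_within (R : realType) (V : normedModType R) (A : set R)
    (u : R -> V) (t : R) (l : V) : Prop :=
  (s - t)^-1 *: (u s - u t) @[s --> within A t^'] --> l.

(* Classical solutions on [0, b]: y differentiable, z continuous.  The coupled
   system is obtained from (f1, f2), the subsystem in which y2 is frozen from
   (f1, 0), and the one in which y1 is frozen from (0, f2). *)
Definition is_solution (R : realType) (ny1 ny2 nz1 nz2 : nat)
    (f1 : dae_state R ny1 ny2 nz1 nz2 -> 'rV[R]_ny1)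
    (f2 : dae_state R ny1 ny2 nz1 nz2 -> 'rV[R]_ny2)
    (g1 : dae_state R ny1 ny2 nz1 nz2 -> 'rV[R]_nz1)
    (g2 : dae_state R ny1 ny2 nz1 nz2 -> 'rV[R]_nz2)
    (b : R) (x0 : dae_state R ny1 ny2 nz1 nz2)
    (x : R -> dae_state R ny1 ny2 nz1 nz2) : Prop :=
  [/\ x 0 = x0,
      {within `[0, b], continuous (fun t => (x t).2)} &
      forall t : R, 0 <= t <= b ->
        [/\ is_derive_within `[0, b] (fun s => (x s).1.1) t (f1 (x t)),
            g1 (x t) = 0,
            is_derive_within `[0, b] (fun s => (x s).1.2) t (f2 (x t)) &
            g2 (x t) = 0]].

Definition is_unique_solution (R : realType) (ny1 ny2 nz1 nz2 : nat)
    (f1 : dae_state R ny1 ny2 nz1 nz2 -> 'rV[R]_ny1)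
    (f2 : dae_state R ny1 ny2 nz1 nz2 -> 'rV[R]_ny2)
    (g1 : dae_state R ny1 ny2 nz1 nz2 -> 'rV[R]_nz1)
    (g2 : dae_state R ny1 ny2 nz1 nz2 -> 'rV[R]_nz2)
    (b : R) (x0 : dae_state R ny1 ny2 nz1 nz2)
    (x : R -> dae_state R ny1 ny2 nz1 nz2) : Prop :=
  is_solution f1 f2 g1 g2 b x0 x /\
  forall x' : R -> dae_state R ny1 ny2 nz1 nz2,
    is_solution f1 f2 g1 g2 b x0 x' ->
    forall t : R, 0 <= t <= b -> x' t = x t.

(* The matrix d(g1, g2)/d(z1, z2) at p = (y, z), transposed since the library
   lets Jacobians act on row vectors. *)
Definition constraint_jacobian (R : realType) (ny1 ny2 nz1 nz2 : nat)
    (g1 : dae_state R ny1 ny2 nz1 nz2 -> 'rV[R]_nz1)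
    (g2 : dae_state R ny1 ny2 nz1 nz2 -> 'rV[R]_nz2)
    (p : dae_state R ny1 ny2 nz1 nz2) : 'M[R]_(nz1 + nz2) :=
  jacobian (fun w : 'rV[R]_(nz1 + nz2) =>
              row_mx (g1 (p.1, (lsubmx w, rsubmx w)))
                     (g2 (p.1, (lsubmx w, rsubmx w))))
           (row_mx p.2.1 p.2.2).

(* Phi h p is the result of one step of length h from the state p.  The
   one-step error is measured against exact solutions of the (sub)system
   starting at p, uniformly over the consistent states p near the trajectory
   x([0, T]).  The algebraic component of Phi h p is determined by the
   constraints; bounding its error as well selects the branch of the
   constraint set that contains the exact solution. *)
Definition has_order (R : realType) (ny1 ny2 nz1 nz2 : nat)
    (f1 : dae_state R ny1 ny2 nz1 nz2 -> 'rV[R]_ny1)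
    (f2 : dae_state R ny1 ny2 nz1 nz2 -> 'rV[R]_ny2)
    (g1 : dae_state R ny1 ny2 nz1 nz2 -> 'rV[R]_nz1)
    (g2 : dae_state R ny1 ny2 nz1 nz2 -> 'rV[R]_nz2)
    (T : R) (x : R -> dae_state R ny1 ny2 nz1 nz2) (p : nat)
    (Phi : R -> dae_state R ny1 ny2 nz1 nz2 -> dae_state R ny1 ny2 nz1 nz2)
    : Prop :=
  exists C h0 delta : R,
    [/\ 0 < C, 0 < h0, 0 < delta &
      forall (t : R) (q : dae_state R ny1 ny2 nz1 nz2) (h : R),
        0 <= t <= T -> `|q - x t| < delta -> g1 q = 0 -> g2 q = 0 ->
        0 < h <= h0 ->
        [/\ g1 (Phi h q) = 0,
            g2 (Phi h q) = 0 &
            forall u : R -> dae_state R ny1 ny2 nz1 nz2,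
              is_solution f1 f2 g1 g2 h q u ->
              `|Phi h q - u h| <= C * h ^+ p.+1]].

Definition lie_trotter (R : realType) (X : Type) (Phi1 Phi2 : R -> X -> X)
    (h : R) (q : X) : X :=
  Phi2 h (Phi1 h q).

Definition strang (R : realType) (X : Type) (Phi1 Phi2 Phi3 : R -> X -> X)
    (h : R) (q : X) : X :=
  Phi3 (h / 2) (Phi2 h (Phi1 (h / 2) q)).

Definition is_convergent (R : realType) (ny1 ny2 nz1 nz2 : nat)
    (T : R) (x0 : dae_state R ny1 ny2 nz1 nz2)
    (x : R -> dae_state R ny1 ny2 nz1 nz2) (p : nat)
    (Psi : R -> dae_state R ny1 ny2 nz1 nz2 -> dae_state R ny1 ny2 nz1 nz2)
    : Prop :=
  exists C h0 : R,
    [/\ 0 < C, 0 < h0 &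
      forall N : nat, (0 < N)%N ->
        let h := T / N%:R in
        h <= h0 ->
        forall n : nat, (n <= N)%N ->
          let xn := iter n (Psi h) x0 in
          let tn := n%:R * h in
          `|xn.1 - (x tn).1| + `|xn.2 - (x tn).2| <= C * h ^+ p].

(* Main.v *)
Require Import Defs.
From HB Require Import structures.
From mathcomp Require Import all_boot all_order all_algebra.
From mathcomp Require Import all_classical all_reals all_analysis.
From mathcomp Require Import ring lra.

Set Implicit Arguments.
Unset Strict Implicit.
Unset Printing Implicit Defensive.

Import Order.TTheory GRing.Theory Num.Theory.
Import numFieldNormedType.Exports.

Local Open Scope classical_set_scope.
Local Open Scope ring_scope.

(* The constraints are differentiated instead of being solved by the implicit
   function theorem: with w chosen so that D_h g + w J = 0, the field
   F = (h, w) is tangent to the constraint set, so the integral curves of F that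
   start at consistent states are exactly the DAE solutions.  This applies to both
   subsystems (h = (f1, 0) and h = (0, f2)) and to the coupled system, and
   the three fields satisfy F = F1 + F2.
   Euler polygons provide the solutions of the subsystems, uniformly near the
   trajectory; hence a step of a method of order p agrees with the Taylor
   polynomial of F_i up to O(h^(p+1)).  Composing these polynomials gives
   q + h F(q) for Lie-Trotter splitting and q + h F(q) + h^2/2 F'(q) F(q) for
   Strang splitting, up to O(h^2) and O(h^3).  These polynomials are
   (1 + O(h))-Lipschitz in q, so the discrete Gronwall inequality concludes
   without any stability estimate for the flows or the numerical methods. *)

(** * Functions of class C^k on finite-dimensional spaces *)

(** The hypothesis [has_order] measures a step only against exact solutions of a subsystem, so it
    says nothing until a solution on [[0, h]] starting at the current numerical state is known to
    exist. This is why an existence theorem is proved, with a radius and constants shared by all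
    starting points near the compact set x([0,T]). It also speaks only of consistent states:
    numerical states stay consistent by hypothesis, whereas the Taylor polynomials may leave the
    constraint set. They can still be compared because F is defined on a full neighbourhood of the
    trajectory. All estimates hold only in a tube around the trajectory, so convergence and
    confinement of the numerical states to the tube must be proved simultaneously. Third-order
    remainders require F to be differentiable with Lipschitz derivative; this is obtained from class
    C^2. Since F contains the Jacobian of the constraints, g is taken of class C^3. *)

Definition coordinate_system (R : realType) (V : normedModType R) (I : finType)
    (e : I -> V) (c : I -> {linear V -> R^o}) : Prop :=
  (forall i, continuous (c i)) /\ forall v, v = \sum_i c i v *: e i.

(** The vectors [e i] only have to span, through continuous coordinate forms. Mean values and
    limits, which are real-variable tools, are then applied one coordinate at a time. *)
Definition fin_dim (R : realType) (V : normedModType R) : Prop :=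
  exists (I : finType) (e : I -> V) (c : I -> {linear V -> R^o}),
    coordinate_system e c.

Section FiniteDimension.
Context {R : realType}.
Implicit Types V W : normedModType R.

Lemma continuous_linear_le V W (l : {linear V -> W}) :
  continuous l -> exists2 K, 0 < K & forall v, `|l v| <= K * `|v|.
Proof.
move=> lc; have /linear_boundedP := (linear_bounded_continuous l).2 lc.
rewrite /bounded_near => -[M [Mr MP]].
exists (Num.max 1 (M + 1)); first by rewrite lt_max ltr01.
move=> v; apply: (MP (Num.max 1 (M + 1))).
by rewrite lt_max ltrDl ltr01 orbT.
Qed.

Lemma cvg_sumr V (T : Type) (F : set_system T) (I : Type) (r : seq I)
    (f : I -> T -> V) (a : I -> V) : Filter F ->
  (forall i, f i x @[x --> F] --> a i) ->
  (\sum_(i <- r) f i x) @[x --> F] --> \sum_(i <- r) a i.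
Proof.
move=> FF fa; elim: r => [|i r IH].
  by under eq_fun do rewrite big_nil; rewrite big_nil; exact: cvg_cst.
by under eq_fun do rewrite big_cons; rewrite big_cons; apply: cvgD.
Qed.

Lemma fin_dim_linear_continuous V W (l : {linear V -> W}) :
  fin_dim V -> continuous l.
Proof.
move=> [I [e [c [cc cE]]]] v.
have -> : (l : V -> W) = fun v => \sum_i c i v *: l (e i).
  by apply/funext => w; rewrite {1}(cE w) linear_sum; apply: eq_bigr => i _; rewrite linearZ.
by apply: cvg_sumr => i; apply: cvgZr_tmp; exact: cc.
Qed.

Lemma norm_le_coordinates V (I : finType) (e : I -> V) c :
  coordinate_system e c -> exists2 B, 0 < B &
  forall v K, 0 <= K -> (forall i, `|c i v| <= K) -> `|v| <= B * K.
Proof.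
move=> [_ cE]; exists (1 + \sum_i `|e i|).
  by rewrite ltr_pwDl// sumr_ge0.
move=> v K K0 vK; rewrite (cE v) mulrDl mul1r mulr_suml.
apply: (le_trans (ler_norm_sum _ _ _)).
rewrite -[leLHS]add0r lerD//; apply: ler_sum => i _.
by rewrite normrZ mulrC ler_wpM2l// vK.
Qed.

(** The linearity equations come as one product so that [rewrite ?H] uses them as a multirule,
    leaving a scalar identity for [field]. *)
Lemma eq_by_functionals V (v w : V) : fin_dim V ->
  (forall l : V -> R,
     (forall x y, l (x + y) = l x + l y) * (forall x, l (- x) = - l x) *
     (forall a x, l (a *: x) = a * l x) * (l 0 = 0) -> l v = l w) -> v = w.
Proof.
move=> [I [e [c [cc cE]]]] vw; rewrite (cE v) (cE w).
apply: eq_bigr => i _; congr (_ *: _); apply: (vw (c i)).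
by do !split; [exact: linearD|exact: linearN|move=> a x; rewrite linearZ|exact: linear0].
Qed.

End FiniteDimension.

(* Identities between linear combinations, reduced by duality to the scalars. *)
Ltac lincomb finV :=
  let H := fresh in
  refine (eq_by_functionals finV _); intros ? H; rewrite ?H; by field.

Section ClassC.
Context {R : realType}.
Implicit Types V W : normedModType R.

Lemma diff_pointwise_sum V W (f f1 f2 : V -> W) (q : V) :
  (forall z, f z = f1 z + f2 z) -> differentiable f1 q -> differentiable f2 q ->
  forall v, 'd f q v = 'd f1 q v + 'd f2 q v.
Proof.
move=> fE d1 d2 v; have -> : f = f1 + f2 by apply/funext => z; rewrite fE.
by rewrite (diffD d1 d2).
Qed.

Lemma of_class_CS V W k (U : set V) (f : V -> W) :
  of_class_C k.+1 U f -> of_class_C k U f.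
Proof.
elim: k f => [|k IH] f /= [df Df].
  by move=> p Up; exact/differentiable_continuous/df.
by split=> // v; apply: IH; exact: Df.
Qed.

Lemma of_class_C_le V W m k (U : set V) (f : V -> W) :
  (m <= k)%N -> of_class_C k U f -> of_class_C m U f.
Proof.
elim: k => [|k IH]; first by rewrite leqn0 => /eqP ->.
by rewrite leq_eqVlt => /predU1P[-> //|mk] /of_class_CS; exact: IH.
Qed.

Lemma near_eq_differentiable V W (f g : V -> W) (a : V) :
  (\near a, f a = g a) -> differentiable f a -> differentiable g a.
Proof.
move=> fg df.
have fga : f a = g a by exact: nbhs_singleton fg.
have gE : g \o shift a = cst (g a) + 'd f a +o_ 0 id.
  apply/eqaddoP => eps eps0.
  have /eqaddoP/(_ eps eps0) := diff_locally df.
  have : \forall y \near 0, f (y + a) = g (y + a).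
    by have := fg; rewrite (near_shift 0 a) subr0.
  apply: filterS2 => y /= fgy.
  rewrite -[X in `|X| <= _ -> _]/(f (y + a) - (f a + 'd f a y)).
  rewrite -[X in _ -> `|X| <= _]/(g (y + a) - (g a + 'd f a y)).
  by rewrite fgy fga.
have gd : 'd g a = 'd f a :> (V -> W).
  by apply: diff_unique => //; exact: diff_continuous.
by apply/diff_locallyP; rewrite gd; split => //; exact: diff_continuous.
Unshelve. all: by end_near. Qed.

(** Openness of [U] turns agreement on [U] into agreement near each of its points, so the
    directional derivatives agree on [U] too. A function may thus be replaced by a formula valid
    only on [U]. *)
Lemma of_class_C_eq V W k (U : set V) (f g : V -> W) : open U ->
  (forall p, U p -> f p = g p) -> of_class_C k U f -> of_class_C k U g.
Proof.
move=> oU; elim: k f g => [|k IH] f g fg /=.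
  move=> fc p Up; suff : g @ p --> f p by rewrite (fg _ Up).
  apply: cvg_trans (fc _ Up); apply: near_eq_cvg.
  by near=> q; apply: fg; near: q; exact: open_nbhs_nbhs.
have fgn p : U p -> \near p, f p = g p.
  by move=> Up; near=> q; apply: fg; near: q; exact: open_nbhs_nbhs.
move=> [df Df]; split=> [p Up|v].
  by apply: near_eq_differentiable (df _ Up); exact: fgn.
apply: (IH _ _ _ (Df v)) => p Up.
by apply: near_eq_derive; exact: fgn.
Unshelve. all: by end_near. Qed.

Lemma of_class_C_cst V W k (U : set V) (a : W) : of_class_C k U (cst a).
Proof.
elim: k a => [|k IH] a /=; first by move=> p _; exact: cst_continuous.
split=> [p _|v]; first exact: differentiable_cst.
have -> : 'D_v (cst a) = cst 0 :> (V -> W) by apply/funext => p; exact: derive_cst.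
exact: IH.
Qed.

Lemma of_class_C_comp_linear V W W' k (U : set V) (l : {linear W -> W'})
    (f : V -> W) : open U -> continuous l ->
  of_class_C k U f -> of_class_C k U (l \o f).
Proof.
move=> oU lc; elim: k f => [|k IH] f /=.
  by move=> fc p Up; apply: continuous_comp; [exact: fc|exact: lc].
move=> [df Df].
have dl p : U p -> 'd (l \o f) p = l \o 'd f p :> (V -> W').
  move=> Up; rewrite diff_comp ?diff_lin//; first exact: df.
  exact: linear_differentiable.
have dlf p : U p -> differentiable (l \o f) p.
  move=> Up; apply: differentiable_comp; first exact: df.
  exact: linear_differentiable.
split=> [//|v]; apply: of_class_C_eq (IH _ (Df v)) => // p Up /=.
by rewrite (deriveE _ (df _ Up)) (deriveE _ (dlf _ Up)) dl.
Qed.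

Lemma of_class_CD V W k (U : set V) (f g : V -> W) : open U ->
  of_class_C k U f -> of_class_C k U g -> of_class_C k U (f \+ g).
Proof.
move=> oU; elim: k f g => [|k IH] f g /=.
  by move=> fc gc p Up; apply: continuousD; [exact: fc|exact: gc].
move=> [df Df] [dg Dg]; split=> [p Up|v].
  by apply: differentiableD; [exact: df|exact: dg].
apply: of_class_C_eq (IH _ _ (Df v) (Dg v)) => // p Up /=.
by rewrite deriveD//; exact/diff_derivable/df || exact/diff_derivable/dg.
Qed.

Lemma of_class_C_sum V W k (U : set V) (I : Type) (r : seq I)
    (f : I -> V -> W) : open U -> (forall i, of_class_C k U (f i)) ->
  of_class_C k U (fun p => \sum_(i <- r) f i p).
Proof.
move=> oU fk; elim: r => [|i r IH].
  by under eq_fun do rewrite big_nil; exact: of_class_C_cst.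
by under eq_fun do rewrite big_cons; exact: of_class_CD.
Qed.

Lemma of_class_CM V k (U : set V) (f g : V -> R) : open U ->
  of_class_C k U f -> of_class_C k U g -> of_class_C k U (f \* g).
Proof.
move=> oU; elim: k f g => [|k IH] f g.
  by move=> fc gc p Up; apply: continuousM; [exact: fc|exact: gc].
move=> fk gk; have [df Df] := fk; have [dg Dg] := gk; split=> [p Up|v].
  by apply: differentiableM; [exact: df|exact: dg].
apply: (@of_class_C_eq _ _ _ _ ((f \* 'D_v g) \+ (g \* 'D_v f))) => //.
  by move=> p Up; rewrite deriveM//; exact/diff_derivable/df || exact/diff_derivable/dg.
by apply: of_class_CD => //; apply: IH => //; (exact: of_class_CS || exact: Df || exact: Dg).
Qed.

Lemma of_class_C_prod V k (U : set V) (I : Type) (r : seq I)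
    (f : I -> V -> R) : open U -> (forall i, of_class_C k U (f i)) ->
  of_class_C k U (fun p => \prod_(i <- r) f i p).
Proof.
move=> oU fk; elim: r => [|i r IH].
  by under eq_fun do rewrite big_nil; exact: of_class_C_cst.
by under eq_fun do rewrite big_cons; exact: of_class_CM.
Qed.

Lemma of_class_CV V k (U : set V) (f : V -> R) : open U ->
  (forall p, U p -> f p != 0) ->
  of_class_C k U f -> of_class_C k U (fun p => (f p)^-1).
Proof.
move=> oU f0; elim: k => [|k IH].
  by move=> fc p Up; apply: continuousV; [exact: f0|exact: fc].
move=> fk; have [df Df] := fk; split=> [p Up|v].
  by apply: differentiableV; [exact: df|exact: f0].
have Vk := IH (of_class_CS fk).
apply: (@of_class_C_eq _ _ _ _
  (((cst (-1)) \* ((fun p => (f p)^-1) \* (fun p => (f p)^-1))) \* 'D_v f)) => //.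
  move=> p Up /=; rewrite deriveV ?f0//; last exact/diff_derivable/df.
  by rewrite mulN1r -expr2 exprVn.
apply: of_class_CM; [by []| |exact: Df].
apply: of_class_CM; [by []|exact: of_class_C_cst|].
exact: of_class_CM.
Qed.

Lemma of_class_C_coordinates V W k (U : set V) (I : finType) (e : I -> W) c
    (f : V -> W) : open U -> coordinate_system e c ->
  (forall i, of_class_C k U (c i \o f)) -> of_class_C k U f.
Proof.
move=> oU [cc cE] fk.
apply: (@of_class_C_eq _ _ _ _ (fun p => \sum_i c i (f p) *: e i)); first by [].
  by move=> p _; rewrite -cE.
apply: of_class_C_sum => // i.
pose s : R^o -> W := fun x => x *: e i.
have sl : linear s by move=> a x y; rewrite /s scalerDl scalerA.
pose ls := GRing.isLinear.Build _ _ _ _ s sl.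
pose l : {linear R^o -> W} := HB.pack s ls.
apply: (@of_class_C_comp_linear _ _ _ _ _ l _ oU _ (fk i)).
by move=> x; apply: continuousZr_tmp; exact: cvg_id.
Qed.

Lemma of_class_C_det V k (U : set V) n (M : V -> 'M[R]_n) : open U ->
  (forall i j, of_class_C k U (fun p => M p i j)) ->
  of_class_C k U (fun p => \det (M p)).
Proof.
move=> oU Mk; rewrite /determinant; apply: of_class_C_sum => // s.
apply: (@of_class_CM _ _ _ (cst _)) => //; first exact: of_class_C_cst.
exact: of_class_C_prod.
Qed.

(** Cramer's rule: determinant and cofactors are polynomials in the entries, and the determinant
    does not vanish on [U]. *)
Lemma of_class_C_invmx V k (U : set V) n (M : V -> 'M[R]_n) : open U ->
  (forall p, U p -> M p \in unitmx) ->
  (forall i j, of_class_C k U (fun p => M p i j)) ->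
  forall i j, of_class_C k U (fun p => invmx (M p) i j).
Proof.
move=> oU Mu Mk i j.
apply: (@of_class_C_eq _ _ _ _
  ((fun p => (\det (M p))^-1) \* (fun p => cofactor (M p) j i))) => //.
  by move=> p Up /=; rewrite /invmx Mu// !mxE.
apply: of_class_CM => //.
  apply: of_class_CV => //; last exact: of_class_C_det.
  by move=> p Up; have := Mu _ Up; rewrite unitmxE unitfE.
rewrite /cofactor.
apply: (@of_class_CM _ _ _ (cst _)) => //; first exact: of_class_C_cst.
apply: of_class_C_det => // a b.
by apply: of_class_C_eq (Mk _ _) => // p _; rewrite !mxE.
Qed.

(** [of_class_C] differentiates in fixed directions only. A direction that varies with the point is
    expanded in coordinates, and linearity of the differential moves the dependence into scalar
    factors. *)
Lemma of_class_C_derive V W k (U : set V) (f : V -> W) (h : V -> V) :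
  open U -> fin_dim V -> fin_dim W -> of_class_C k.+1 U f ->
  of_class_C k U h -> of_class_C k U (fun p => 'D_(h p) f p).
Proof.
move=> oU [I [e [c ec]]] [J [e' [c' ec']]] [df Df] hk.
apply: (of_class_C_coordinates oU ec') => j.
apply: (@of_class_C_eq _ _ _ _
  (fun p => \sum_i c i (h p) * c' j ('D_(e i) f p))) => //.
  move=> p Up /=; have dp := df _ Up.
  rewrite deriveE// {2}(ec.2 (h p)) !linear_sum; apply: eq_bigr => i _.
  by rewrite !linearZ deriveE.
apply: of_class_C_sum => // i.
apply: (@of_class_CM _ _ _ (c i \o h) (c' j \o 'D_(e i) f)) => //.
  by apply: of_class_C_comp_linear => //; exact: ec.1.
by apply: of_class_C_comp_linear; [by []|exact: ec'.1|exact: Df].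
Qed.

End ClassC.

(** * Local C^{1,1} estimates *)

Section LocalEstimates.
Context {R : realType}.
Implicit Types V W : normedModType R.

Lemma convex_segment_lt V (a p q : V) r s : `|p - a| < r -> `|q - a| < r ->
  0 <= s <= 1 -> `|p + s *: (q - p) - a| < r.
Proof.
move=> pr qr /andP[s0 s1].
have -> : p + s *: (q - p) - a = (1 - s) *: (p - a) + s *: (q - a).
  rewrite scalerBl scale1r -[RHS]addrA [X in _ = _ + X]addrC -scalerBr.
  have -> : q - a - (p - a) = q - p by rewrite opprB addrA subrK.
  by rewrite addrAC.
apply: (le_lt_trans (ler_normD _ _)); rewrite !normrZ (ger0_norm s0) ger0_norm ?subr_ge0//.
have [->|s0'] := eqVneq s 0; first by rewrite subr0 mul1r mul0r addr0.
have {}s0 : 0 < s by rewrite lt_neqAle eq_sym s0'.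
have /le_lt_trans : (1 - s) * `|p - a| + s * `|q - a| <= (1 - s) * r + s * `|q - a|.
  by rewrite lerD2r ler_wpM2l ?subr_ge0// ltW.
apply; rewrite -[ltRHS](mul1r r) -[X in X * r](subrK s 1) [ltRHS]mulrDl.
by rewrite ltrD2l ltr_pM2l.
Qed.

Lemma segment_MVT V (f : V -> R) (p q : V) :
  (forall s : R, 0 <= s <= 1 -> differentiable f (p + s *: (q - p))) ->
  exists2 s : R, 0 <= s <= 1 & f q - f p = 'd f (p + s *: (q - p)) (q - p).
Proof.
move=> df; pose g (s : R) : V := p + s *: (q - p).
have dg s : is_diff s g (fun t => t *: (q - p)).
  pose m (t : R^o) : V := t *: (q - p).
  have ml : linear m by move=> a x y; rewrite /m scalerDl scalerA.
  pose lm := GRing.isLinear.Build _ _ _ _ m ml.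
  pose l : {linear R^o -> V} := HB.pack m lm.
  have lc : continuous l by move=> x; apply: continuousZr_tmp; exact: cvg_id.
  have dl : is_diff (s : R^o) l l.
    by apply: DiffDef; [exact: linear_differentiable|exact: diff_lin].
  have [d1 d2] := @is_diffD _ _ _ (cst p) l 0 l s _ dl.
  by apply: DiffDef d1 _; rewrite d2 add0r.
have dfg (s : R) : 0 <= s <= 1 -> is_derive s (1 : R) (f \o g : R -> R) ('d f (g s) (q - p)).
  move=> s01; have d1 := df _ s01; have [d2 d2E] := dg s.
  have d3 : differentiable (f \o g) s by exact: differentiable_comp.
  apply: DeriveDef; first exact: diff_derivable.
  by rewrite deriveE// diff_comp//= d2E scale1r.
have [|s01|s] := @MVT R (f \o g) (fun s => 'd f (g s) (q - p)) 0 1 ltr01.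
- by move=> s; rewrite in_itv/= => /andP[/ltW s0 /ltW s1]; apply: dfg; rewrite s0.
- apply: derivable_within_continuous => s; rewrite in_itv/= => s1.
  by have [] := dfg _ s1.
- rewrite in_itv/= => /andP[/ltW s0 /ltW s1] E.
  exists s; first by rewrite s0.
  by move: E; rewrite /g /= scale1r scale0r addr0 subr0 mulr1 subrKC.
Qed.

Lemma C1_lipschitz_near V (U : set V) (f : V -> R) (a : V) : fin_dim V ->
  open U -> U a -> of_class_C 1 U f ->
  exists2 K, 0 < K & \forall p \near a & p' \near a,
    `|f p' - f p| <= K * `|p' - p| /\ forall v, `|'d f p v| <= K * `|v|.
Proof.
move=> [I [e [c [cc cE]]]] oU Ua [df Df].
have /fin_all_exists[B BP] i : exists B, 0 < B /\ forall v, `|c i v| <= B * `|v|.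
  by have [B] := continuous_linear_le (cc i); exists B.
(* [M i] bounds a partial derivative near [a]; with the bounds [B i] of the coordinate forms these
   add up to the operator bound [K]. The summand 1 keeps [K] positive even for an empty index
   set. *)
pose M i := `|'D_(e i) f a| + 1.
pose K := 1 + \sum_i B i * M i.
have M0 i : 0 < M i by rewrite /M ltr_wpDl.
have K0 : 0 < K.
  by rewrite /K ltr_pwDl// sumr_ge0// => i _; rewrite mulr_ge0 ?ltW//; have [] := BP i.
have MP : \forall p \near a, U p /\ forall i, `|'D_(e i) f p| <= M i.
  near=> p; split; first by near: p; exact: open_nbhs_nbhs.
  near: p; apply: filter_forall => i.
  have : 'D_(e i) f p @[p --> a] --> 'D_(e i) f a by apply: Df.
  move=> /cvgrPdist_lt /(_ _ ltr01); apply: filterS => p /ltW.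
  rewrite distrC => H; rewrite /M -[X in `|X|](subrK ('D_(e i) f a)) addrC.
  by apply: (le_trans (ler_normD _ _)); rewrite lerD2l.
have dK p : U p -> (forall i, `|'D_(e i) f p| <= M i) ->
    forall v, `|'d f p v| <= K * `|v|.
  move=> Up pM v; rewrite {1}(cE v) linear_sum.
  apply: (le_trans (ler_norm_sum _ _ _)).
  rewrite /K mulrDl mul1r -[leLHS]add0r lerD// mulr_suml; apply: ler_sum => i _.
  rewrite linearZ normrZ -deriveE; last exact: df.
  by rewrite mulrAC ler_pM//; have [_] := BP i; apply.
have /nbhs_normP[r /= r0 rP] := MP.
exists K => //.
exists ([set p | `|p - a| < r], [set p | `|p - a| < r]) => /=.
  by split; apply/nbhs_normP; exists r => //= p /=; rewrite distrC.
move=> [p p'] /= [pr pr'].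
have rP' q : `|q - a| < r -> U q /\ forall i, `|'D_(e i) f q| <= M i.
  by move=> qr; apply: rP => /=; rewrite distrC.
split; last by move=> v; apply: dK; have [] := rP' _ pr.
have [s s01|s s01 ->] := @segment_MVT V f p p'.
  by apply: df; have [] := rP' _ (convex_segment_lt pr pr' s01).
by have [? ?] := rP' _ (convex_segment_lt pr pr' s01); apply: dK.
Unshelve. all: by end_near. Qed.

(** The estimates behind all later expansions: size, Lipschitz bound, Taylor remainder, operator
    norm of the differential and its Lipschitz bound, with a single constant. *)
Definition C11_at V W (f : V -> W) (K : R) (p p' : V) : Prop :=
  [/\ `|f p| <= K, `|f p' - f p| <= K * `|p' - p|,
      `|f p' - f p - 'd f p (p' - p)| <= K * `|p' - p| ^+ 2,
      forall v, `|'d f p v| <= K * `|v| &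
      forall v, `|'d f p' v - 'd f p v| <= K * `|p' - p| * `|v|].

Lemma C2_C11_near_scalar V (U : set V) (f : V -> R) (a : V) : fin_dim V ->
  open U -> U a -> of_class_C 2 U f ->
  exists2 K, 0 < K & \forall p \near a & p' \near a, C11_at (f : V -> R^o) K p p'.
Proof.
move=> fV oU Ua f2; have [df Df] := f2.
have [K0 K00 K0P] := C1_lipschitz_near fV oU Ua (of_class_CS f2).
have [I [e [c [cc cE]]]] := fV.
have /fin_all_exists[B BP] i : exists B, 0 < B /\ forall v, `|c i v| <= B * `|v|.
  by have [B] := continuous_linear_le (cc i); exists B.
have /fin_all_exists[L LP] i : exists L, 0 < L /\ \forall p \near a & p' \near a,
    `|'D_(e i) f p' - 'D_(e i) f p| <= L * `|p' - p|.
  have [L L0 LP] := C1_lipschitz_near fV oU Ua (Df (e i)); exists L; split => //.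
  by apply: filterS LP => -[p p'] [].
pose K1 := \sum_i B i * L i.
have K10 : 0 <= K1.
  by rewrite sumr_ge0// => i _; rewrite mulr_ge0 ?ltW//; [have [] := BP i|have [] := LP i].
have K1P : \forall p \near a & p' \near a, U p -> U p' ->
    forall v, `|'d f p' v - 'd f p v| <= K1 * `|p' - p| * `|v|.
  have : \forall p \near a & p' \near a, forall i,
      `|'D_(e i) f p' - 'D_(e i) f p| <= L i * `|p' - p|.
    refine (@filter_forall _ I (fun i (x : V * V) =>
      `|'D_(e i) f x.2 - 'D_(e i) f x.1| <= L i * `|x.2 - x.1|)
      (filter_prod (nbhs a) (nbhs a)) _ _) => i.
    by have [] := LP i.
  apply: filterS => -[p p'] /= H Up Up' v.
  rewrite {1 2}(cE v) (linear_sum ('d f p')) (linear_sum ('d f p)) -sumrB.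
  apply: (le_trans (ler_norm_sum _ _ _)).
  rewrite /K1 !mulr_suml; apply: ler_sum => i _.
  rewrite linearZ [X in _ - X]linearZ -scalerBr normrZ -!deriveE; [|exact: df..].
  have -> : B i * L i * `|p' - p| * `|v| = B i * `|v| * (L i * `|p' - p|) by ring.
  by rewrite ler_pM//; have [_] := BP i; apply.
pose K := `|f a| + 1 + K0 + K1.
have K0K : K0 <= K by rewrite /K -addrA addrCA lerDl addr_ge0// addr_ge0.
have K1K : K1 <= K by rewrite /K lerDr addr_ge0 ?(ltW K00)// addr_ge0.
have Kgt0 : 0 < K by exact: lt_le_trans K00 K0K.
have fa : \forall p \near a, U p /\ `|f p| <= K.
  near=> p; split; first by near: p; exact: open_nbhs_nbhs.
  apply: (@le_trans _ _ (`|f a| + 1)).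
    2: by rewrite /K -[leRHS]addrA lerDl addr_ge0// ltW.
  near: p.
  have : f p @[p --> a] --> f a by exact/differentiable_continuous/df.
  move=> /cvgrPdist_lt /(_ _ ltr01); apply: filterS => p /ltW.
  rewrite distrC => H; rewrite -[X in `|X|](subrK (f a)) addrC.
  by apply: (le_trans (ler_normD _ _)); rewrite lerD2l.
exists K => //.
have H : \forall p \near a & p' \near a, [/\ U p /\ `|f p| <= K, U p' /\ `|f p'| <= K,
    forall v, `|'d f p' v - 'd f p v| <= K1 * `|p' - p| * `|v| &
    `|f p' - f p| <= K0 * `|p' - p| /\ forall v, `|'d f p v| <= K0 * `|v|].
  have fa2 : \forall p \near a & p' \near a,
      (U p /\ `|f p| <= K) /\ (U p' /\ `|f p'| <= K).
    by exists ([set p | U p /\ `|f p| <= K], [set p | U p /\ `|f p| <= K]).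
  apply: filterS3 K1P K0P fa2 => -[q q'] /= dK1 fK0 [Uq Uq'].
  by split=> //; apply: dK1; [case: Uq|case: Uq'].
have [[A1 A2] /= [/nbhs_normP[r1 /= r10 r1P] /nbhs_normP[r2 /= r20 r2P]] AP] := H.
pose r := Num.min r1 r2.
have r0 : 0 < r by rewrite lt_min r10.
exists ([set p | `|p - a| < r], [set p | `|p - a| < r]) => /=.
  by split; apply/nbhs_normP; exists r => //= p /=; rewrite distrC.
move=> [p p'] /= [pr pr'].
have rP q q' : `|q - a| < r -> `|q' - a| < r ->
  [/\ U q /\ `|f q| <= K, U q' /\ `|f q'| <= K,
    forall v, `|'d f q' v - 'd f q v| <= K1 * `|q' - q| * `|v| &
    `|f q' - f q| <= K0 * `|q' - q| /\ forall v, `|'d f q v| <= K0 * `|v|].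
  rewrite !lt_min => /andP[qr1 _] /andP[_ qr2]; apply: (AP (q, q')).
  by split; [apply: r1P|apply: r2P] => /=; rewrite distrC.
have [[Up fpK] _ dd [fp dfp]] := rP _ _ pr pr'.
split => //.
- by apply: (le_trans fp); rewrite ler_wpM2r.
(* The mean value theorem turns the remainder into the difference of the differentials at an
   intermediate point and at [p], applied to [p' - p]; this is quadratic by the Lipschitz bound. *)
- have [s s01|s s01 ->] := @segment_MVT V f p p'.
    by apply: df; have [[]] := rP _ _ (convex_segment_lt pr pr' s01) pr'.
  have [_ _ + _] := rP _ _ pr (convex_segment_lt pr pr' s01).
  move=> /(_ (p' - p)) /le_trans; apply.
  rewrite expr2 mulrA ler_wpM2r// addrAC subrr add0r ler_pM//.
  rewrite normrZ; have /andP[s0 s1] := s01.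
  by rewrite (ger0_norm s0) ler_piMl.
- by move=> v; apply: (le_trans (dfp v)); rewrite ler_wpM2r.
- by move=> v; apply: (le_trans (dd v)); rewrite !ler_wpM2r.
Unshelve. all: by end_near. Qed.

Lemma C11_atW V W (f : V -> W) (K K' : R) p p' : K <= K' ->
  C11_at f K p p' -> C11_at f K' p p'.
Proof.
move=> KK' [f1 f2 f3 f4 f5]; split.
- exact: le_trans KK'.
- by apply: (le_trans f2); rewrite ler_wpM2r.
- by apply: (le_trans f3); rewrite ler_wpM2r// sqr_ge0.
- by move=> v; apply: (le_trans (f4 v)); rewrite ler_wpM2r.
- by move=> v; apply: (le_trans (f5 v)); rewrite !ler_wpM2r.
Qed.

(** The mean value theorem fails for vector values, so the scalar result is applied to each
    coordinate and the norm is recovered up to the factor [B]. *)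
Lemma C2_C11_near V W (U : set V) (f : V -> W) (a : V) : fin_dim V ->
  fin_dim W -> open U -> U a -> of_class_C 2 U f ->
  exists2 K, 0 < K & \forall p \near a & p' \near a, C11_at f K p p'.
Proof.
move=> fV [I [e [c ec]]] oU Ua f2; have [df _] := f2.
have [B B0 BP] := norm_le_coordinates ec.
have /fin_all_exists[L LP] i : exists L, 0 < L /\ \forall p \near a & p' \near a,
    C11_at ((c i \o f) : V -> R^o) L p p'.
  have fi2 := of_class_C_comp_linear oU (ec.1 i) f2.
  by have [L L0 LP] := C2_C11_near_scalar fV oU Ua fi2; exists L.
pose L1 := 1 + \sum_i L i.
have L0 : 0 < L1 by rewrite ltr_pwDl// sumr_ge0// => i _; have [/ltW] := LP i.
have LL1 i : L i <= L1.
  rewrite /L1 (bigD1 i)//= addrCA lerDl addr_ge0// sumr_ge0// => j _.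
  by have [/ltW] := LP j.
exists (B * L1); first by rewrite mulr_gt0.
have H : \forall p \near a & p' \near a, forall i, C11_at (c i \o f : V -> R^o) (L i) p p'.
  refine (@filter_forall _ I
    (fun i (x : V * V) => C11_at (c i \o f : V -> R^o) (L i) x.1 x.2)
    (filter_prod (nbhs a) (nbhs a)) _ _) => i.
  by have [] := LP i.
have fa2 : \forall p \near a & p' \near a, U p /\ U p'.
  by exists (U, U) => //=; split; exact: open_nbhs_nbhs.
apply: filterS2 H fa2 => -[p p'] /= H [Up Up'].
have dcf i q : U q -> forall v, 'd (c i \o f : V -> R^o) q v = c i ('d f q v).
  move=> Uq v; rewrite diff_comp ?diff_lin//; [exact: ec.1|exact: df|].
  by apply: linear_differentiable; exact: ec.1.
have {}H i : C11_at (c i \o f : V -> R^o) L1 p p' by exact: C11_atW (LL1 i) (H i).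
have L1' := ltW L0.
split.
- by apply: BP => // i; have [] := H i.
- rewrite -mulrA; apply: BP; first by rewrite mulr_ge0.
  by move=> i; rewrite linearB; have [] := H i.
- rewrite -mulrA; apply: BP; first by rewrite mulr_ge0// sqr_ge0.
  by move=> i; rewrite linearB [c i (_ - f p)]linearB -dcf//; have [] := H i.
- move=> v; rewrite -mulrA; apply: BP; first by rewrite mulr_ge0.
  by move=> i; rewrite -dcf//; have [] := H i.
- move=> v; rewrite -!mulrA; apply: BP; first by rewrite !mulr_ge0.
  by move=> i; rewrite linearB -!dcf// mulrA; have [] := H i.
Qed.

(* A single parameter r gives the radius r and the constant 1 / r, so that
   the property is weakened by decreasing r. *)
Definition C11_ball V W (f : V -> W) (p : V) (r : R) : Prop :=
  forall q q', `|q - p| < r -> `|q' - p| < r -> C11_at f r^-1 q q'.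

Lemma C11_ball_near V W (U : set V) (f : V -> W) (a : V) : fin_dim V ->
  fin_dim W -> open U -> U a -> of_class_C 2 U f ->
  \forall p \near a & r \near (0 : R)^'+, C11_ball f p r.
Proof.
move=> fV fW oU Ua f2.
have [K K0 [[A1 A2] /= [/nbhs_normP[r1 /= r10 r1P] /nbhs_normP[r2 /= r20 r2P]] AP]] :=
  C2_C11_near fV fW oU Ua f2.
(* The half lets the ball of radius [r] about [p] stay in both neighbourhoods of [a]; the bound
   [K^-1] makes [r^-1] at least [K]. *)
pose r0 := Num.min (Num.min r1 r2 / 2) K^-1.
have r00 : 0 < r0 by rewrite lt_min invr_gt0 K0 divr_gt0// lt_min r10.
exists ([set p | `|p - a| < r0], [set r | 0 < r < r0]) => /=.
  split; first by apply/nbhs_normP; exists r0 => //= p /=; rewrite distrC.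
  by near=> r; apply/andP; split => //; near: r; exact: nbhs_right_lt.
move=> [p r] /= [pa /andP[r_gt0 rr0]] q q' qp q'p.
have near_a z : `|z - p| < r -> `|z - a| < Num.min r1 r2.
  move=> zp; have -> : z - a = (z - p) + (p - a) by rewrite addrA subrK.
  apply: (le_lt_trans (ler_normD _ _)); rewrite [ltRHS]splitr; apply: ltrD.
    by apply: (lt_trans zp); apply: (lt_le_trans rr0); rewrite ge_min lexx.
  by apply: (lt_le_trans pa); rewrite ge_min lexx.
apply: (@C11_atW _ _ _ K).
  rewrite -[K]invrK lef_pV2 ?posrE ?invr_gt0//.
  by apply: (le_trans (ltW rr0)); rewrite ge_min lexx orbT.
apply: (AP (q, q')); split; [apply: r1P|apply: r2P] => /=; rewrite distrC.
  by have := near_a _ qp; rewrite lt_min => /andP[].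
by have := near_a _ q'p; rewrite lt_min => /andP[].
Unshelve. all: by end_near. Qed.

Lemma ball_sub_near V (U : set V) (a : V) : open U -> U a ->
  \forall p \near a & r \near (0 : R)^'+, forall q, `|q - p| < r -> U q.
Proof.
move=> oU Ua; have /nbhs_normP[r1 /= r10 r1P] := open_nbhs_nbhs (conj oU Ua).
exists ([set p | `|p - a| < r1 / 2], [set r | 0 < r < r1 / 2]) => /=.
  split; first by apply/nbhs_normP; exists (r1 / 2);
    rewrite /= ?divr_gt0//= => p /=; rewrite distrC.
  by near=> r; apply/andP; split => //; near: r; apply: nbhs_right_lt; rewrite divr_gt0.
move=> [p r] /= [pa /andP[r_gt0 rr1]] q qp; apply: r1P => /=.
have -> : a - q = - ((q - p) + (p - a)) by rewrite addrA subrK opprB.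
rewrite normrN; apply: (le_lt_trans (ler_normD _ _)); rewrite [ltRHS]splitr.
by apply: ltrD => //; exact: lt_trans rr1.
Unshelve. all: by end_near. Qed.

(** Compactness in its near-covering form, with the radii tending to 0 from the right as parameter
    filter: local validity for all small radii becomes validity of one radius on all of [A]. *)
Lemma compact_uniform_radius V (A : set V) (P : V -> R -> Prop) : compact A ->
  (forall a, A a -> \forall p \near a & r \near (0 : R)^'+, P p r) ->
  exists2 r, 0 < r & forall p, A p -> P p r.
Proof.
move=> /compact_near_coveringP Ac AP.
have H : \forall r \near (0 : R)^'+, A `<=` [set p | P p r].
  by apply: (Ac _ _ (fun r p => P p r)) => a /AP.
have [r [r0 rP]] : exists r, 0 < r /\ A `<=` [set p | P p r].
  by apply: (@filter_ex _ ((0 : R)^'+)); near=> r; split=> //; near: r.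
by exists r.
Unshelve. all: by end_near. Qed.

End LocalEstimates.

(** * Row vectors and products as finite-dimensional spaces *)

Section FiniteDimensionInstances.
Context {R : realType}.

Definition rV_coord n (i : 'I_n) (M : 'rV[R]_n) : R^o := M 0 i.

Lemma rV_coord_is_linear n (i : 'I_n) : linear (@rV_coord n i).
Proof. by move=> a M N; rewrite /rV_coord !mxE. Qed.

HB.instance Definition _ n (i : 'I_n) :=
  GRing.isLinear.Build R 'rV[R]_n R^o _ (rV_coord i) (rV_coord_is_linear i).

Lemma rV_coordinate_system n :
  coordinate_system (fun i => delta_mx 0 i : 'rV[R]_n) (@rV_coord n).
Proof.
split; first by move=> i; exact: coord_continuous.
by move=> M; rewrite [LHS]row_sum_delta.
Qed.

Lemma fin_dim_rV n : fin_dim 'rV[R]_n.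
Proof. by exists 'I_n, (fun i => delta_mx 0 i), (@rV_coord n); exact: rV_coordinate_system. Qed.

Lemma fin_dim_prod (V W : normedModType R) :
  fin_dim V -> fin_dim W -> fin_dim (V * W)%type.
Proof.
move=> [I [e [c [cc cE]]]] [J [e' [c' [cc' cE']]]].
pose d (k : I + J) (p : V * W) : R^o :=
  match k with inl i => c i p.1 | inr j => c' j p.2 end.
have dl k : linear (d k) by move=> a p q; case: k => k /=; rewrite linearP.
pose dL k : {linear (V * W)%type -> R^o} :=
  HB.pack (d k) (GRing.isLinear.Build _ _ _ _ (d k) (dl k)).
pose b (k : I + J) : V * W :=
  match k with inl i => (e i, 0) | inr j => (0, e' j) end.
exists (I + J)%type, b, dL; split.
  move=> [i|j] p /=; apply: continuous_comp; [|exact: cc| |exact: cc'].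
    exact: cvg_fst.
  exact: cvg_snd.
move=> [v w]; rewrite big_sumType/=.
rewrite [X in _ = X + _](_ : _ = (v, 0)); last first.
  rewrite {2}(cE v); elim/big_ind2: _ => [//|? p ? q -> ->|i _ /=].
    by congr pair; rewrite addr0.
  by congr pair; rewrite scaler0.
rewrite [X in _ = _ + X](_ : _ = (0, w)); last first.
  rewrite {2}(cE' w); elim/big_ind2: _ => [//|? p ? q -> ->|i _ /=].
    by congr pair; rewrite addr0.
  by congr pair; rewrite scaler0.
by congr pair; rewrite ?addr0 ?add0r.
Qed.

End FiniteDimensionInstances.

(** * Integral curves *)

Section IncrementBounds.
Context {R : realType}.
Implicit Types V : normedModType R.

(* Cutting [0, h] into N pieces turns the quadratic terms into O(1/N). *)
Lemma increment_le V (G : R -> V) (h a b : R) : 0 <= h -> 0 <= b ->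
  (forall s t, 0 <= s -> s <= t -> t <= h ->
     `|G t - G s| <= a * (t - s) + b * (t - s) ^+ 2) ->
  `|G h - G 0| <= a * h.
Proof.
move=> h0 b0 GP; apply/ler_addgt0Pr => eps eps0.
pose N := Num.truncn (b * h ^+ 2 / eps).
pose d := h / N.+1%:R.
have d0 : 0 <= d by rewrite divr_ge0.
have NdE : N.+1%:R * d = h by rewrite /d mulrC divfK// pnatr_eq0.
have step k : (k <= N.+1)%N -> `|G (k%:R * d) - G 0| <= k%:R * (a * d + b * d ^+ 2).
  elim: k => [|k IH] kN; first by rewrite !mul0r subrr normr0.
  have -> : G (k.+1%:R * d) - G 0 = (G (k.+1%:R * d) - G (k%:R * d)) + (G (k%:R * d) - G 0).
    by rewrite addrA subrK.
  apply: (le_trans (ler_normD _ _)).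
  have S1 : k.+1%:R = 1 + k%:R :> R by rewrite -add1n natrD.
  rewrite [leRHS](_ : _ = (a * d + b * d ^+ 2) + k%:R * (a * d + b * d ^+ 2)).
    2: by rewrite S1 mulrDl mul1r.
  apply: lerD; last by rewrite IH// ltnW.
  have dE : k.+1%:R * d - k%:R * d = d by rewrite S1 mulrDl mul1r addrK.
  rewrite -{3 4}dE; apply: GP.
  - by rewrite mulr_ge0.
  - by rewrite ler_wpM2r// ler_nat.
  - by rewrite -NdE ler_wpM2r// ler_nat.
have := step _ (leqnn _); rewrite NdE => /le_trans; apply.
rewrite mulrDr mulrCA NdE lerD2l.
have -> : N.+1%:R * (b * d ^+ 2) = b * h ^+ 2 / N.+1%:R
  by rewrite /d; field; rewrite nat1r pnatr_eq0.
rewrite ler_pdivrMr ?ltr0Sn// [eps * _]mulrC -ler_pdivrMr//.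
by apply: ltW; exact: truncnS_gt.
Qed.

Lemma discrete_gronwall (e : nat -> R) (A B : R) (n : nat) : 0 <= A -> 0 <= B ->
  0 <= e 0%N ->
  (forall k, (k < n)%N -> e k.+1 <= (1 + A) * e k + B) ->
  e n <= expR (A * n%:R) * (e 0%N + n%:R * B).
Proof.
move=> A0 B0 e0 eP.
have A1 : 0 <= 1 + A by rewrite addr_ge0.
have H k : (k <= n)%N -> e k <= (1 + A) ^+ k * (e 0%N + k%:R * B).
  elim: k => [_|k IH kn]; first by rewrite expr0 mul0r addr0 mul1r.
  apply: (le_trans (eP _ kn)).
  rewrite [leRHS](_ : _ = (1 + A) * ((1 + A) ^+ k * (e 0%N + k%:R * B)) + (1 + A) ^+ k.+1 * B).
    2: by rewrite -natr1 exprS; ring.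
  apply: lerD; first by rewrite ler_wpM2l// IH// ltnW.
  by rewrite ler_peMl// exprn_ege1// lerDl.
apply: (le_trans (H _ (leqnn _))); rewrite ler_wpM2r//.
  by rewrite addr_ge0// mulr_ge0.
rewrite expRM_natr; apply: lerXn2r; rewrite ?nnegrE ?expR_ge0//.
exact: expR_ge1Dx.
Qed.

(** [V] is not assumed complete: the coordinates converge as telescoping real series dominated by a
    geometric one, and the limit is reassembled from them. *)
Lemma geometric_increments_cvg V (a : nat -> V) (C : R) : fin_dim V ->
  (forall n, `|a n.+1 - a n| <= C * 2^-1 ^+ n) ->
  exists l : V, a n @[n --> \oo] --> l.
Proof.
move=> [I [e [c [cc cE]]]] aC.
have C0 : 0 <= C by have := le_trans (normr_ge0 _) (aC 0%N); rewrite expr0 mulr1.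
have /fin_all_exists[l lP] i : exists l : R, (c i (a n) : R) @[n --> \oo] --> l.
  have [B B0 BP] := continuous_linear_le (cc i).
  pose b n : R := c i (a n).
  have cb : cvgn (series (telescope b)).
    apply: (@normed_cvg _ R^o).
    apply: (@series_le_cvg _ _ (geometric (B * C) 2^-1)).
    - by move=> n /=.
    - by move=> n /=; rewrite !mulr_ge0// ltW.
    - move=> n /=; have -> : telescope b n = c i (a n.+1 - a n) by rewrite linearB.
      by apply: (le_trans (BP _)); rewrite -mulrA ler_pM2l.
    - by apply: is_cvg_geometric_series; rewrite ger0_norm// invf_lt1// ltr1n.
  exists (b 0%N + limn (series (telescope b))).
  rewrite (_ : (fun n => c i (a n) : R) = (fun n => b 0%N + series (telescope b) n)).
    by apply: cvgD => //; exact: cvg_cst.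
  by apply/funext => n; rewrite -eq_sum_telescope.
exists (\sum_i l i *: e i).
rewrite (_ : a = fun n => \sum_i c i (a n) *: e i); last by apply/funext => n; rewrite -cE.
by apply: cvg_sumr => i; apply: cvgZr_tmp.
Qed.

End IncrementBounds.

(* An integral curve of F, in a form which passes to the limit of Euler polygons
   and involves no derivative; C need not be uniform in F or u, because increment_le
   discards quadratic terms. *)
Definition quadratic_curve (R : realType) (V : normedModType R) (F : V -> V)
    (H : R) (u : R -> V) : Prop :=
  exists C : R, forall s t, 0 <= s <= H -> 0 <= t <= H ->
    `|u t - u s - (t - s) *: F (u s)| <= C * (t - s) ^+ 2.

(** * Existence of integral curves by dyadic Euler polygons *)

Section EulerPolygons.
Context {R : realType} {V : normedModType R} (F : V -> V) (c q : V) (r K H : R).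
Context (K0 : 0 < K) (H0 : 0 < H) (qc : `|q - c| + K * H < r).
Context (FK : forall p, `|p - c| < r -> `|F p| <= K).
Context (finV : fin_dim V).
Context (FL : forall p p', `|p - c| < r -> `|p' - c| < r ->
  `|F p' - F p| <= K * `|p' - p|).

Let step (d : R) (p : V) : V := p + d *: F p.
Let d (n : nat) : R := H * 2^-1 ^+ n.
Let a (n k : nat) : V := iter k (step (d n)) q.
(** Piecewise constant interpolation on dyadic grids, each of which refines the previous one. The
    lag behind [t] is less than one step, an error of order [d n] that disappears in the limit. *)
Let E (n : nat) (t : R) : V := a n (Num.truncn (t / d n)).

Let d_gt0 n : 0 < d n.
Proof. by rewrite mulr_gt0// exprn_gt0// invr_gt0. Qed.

Let dS n : d n.+1 = d n / 2.
Proof. by rewrite /d exprSr mulrA. Qed.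

Let d_total n : (2 ^ n)%:R * d n = H.
Proof.
rewrite /d natrX mulrCA -exprMn divff ?expr1n ?mulr1//.
Qed.

Let grid_le n k : (k <= 2 ^ n)%N -> k%:R * d n <= H.
Proof. by move=> kn; rewrite -(d_total n) ler_wpM2r ?(ltW (d_gt0 _))// ler_nat. Qed.

Let close_in p : `|p - q| <= K * H -> `|p - c| < r.
Proof.
move=> pq; apply: le_lt_trans qc.
have -> : p - c = (q - c) + (p - q) by lincomb finV.
by apply: (le_trans (ler_normD _ _)); rewrite lerD2l.
Qed.

(** Confinement and displacement support each other: the bound at node [k] places it in the ball by
    [qc], where [F] is at most [K], and this gives the bound at the next node. *)
Let a_near n k : (k <= 2 ^ n)%N -> `|a n k - q| <= K * (k%:R * d n).
Proof.
elim: k => [|k IH] kn; first by rewrite subrr normr0 mul0r mulr0.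
have {}IH := IH (ltnW kn).
have inb : `|a n k - c| < r.
  apply: close_in; apply: (le_trans IH).
  by rewrite ler_wpM2l ?(ltW K0)//; apply: grid_le; exact: ltnW.
rewrite [a n k.+1]/(step _ (a n k)) /step addrAC.
apply: (le_trans (ler_normD _ _)); rewrite -natr1 mulrDl mul1r mulrDr lerD//.
rewrite normrZ gtr0_norm// mulrC ler_wpM2r ?(ltW (d_gt0 _))//.
exact: FK.
Qed.

Let a_in n k : (k <= 2 ^ n)%N -> `|a n k - c| < r.
Proof.
move=> kn; apply: close_in; apply: (le_trans (a_near kn)).
by rewrite ler_wpM2l ?(ltW K0)//; exact: grid_le.
Qed.

Let a_lip n k j : (k + j <= 2 ^ n)%N -> `|a n (k + j) - a n k| <= K * (j%:R * d n).
Proof.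
elim: j => [|j IH] kn; first by rewrite addn0 subrr normr0 mul0r mulr0.
rewrite addnS in kn *; have {}IH := IH (ltnW kn).
rewrite [a n (k + j).+1]/(step _ (a n (k + j))) /step addrAC.
apply: (le_trans (ler_normD _ _)); rewrite -natr1 mulrDl mul1r mulrDr lerD//.
rewrite normrZ gtr0_norm// mulrC ler_wpM2r ?(ltW (d_gt0 _))//.
by apply: FK; apply: a_in; exact: ltnW.
Qed.

(** Many small steps against a single long one. A further step adds at most K^2 j d^2, and j^2 + j
    is at most (j+1)^2. *)
Let a_quad n k j : (k + j <= 2 ^ n)%N ->
  `|a n (k + j) - a n k - (j%:R * d n) *: F (a n k)| <= K ^+ 2 * (j%:R * d n) ^+ 2.
Proof.
elim: j => [|j IH] kn; first by rewrite addn0 subrr mul0r scale0r subrr normr0 expr0n mulr0.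
rewrite addnS in kn *; have {}IH := IH (ltnW kn).
rewrite [a n (k + j).+1]/(step _ (a n (k + j))) /step.
have -> : a n (k + j) + d n *: F (a n (k + j)) - a n k - (j.+1%:R * d n) *: F (a n k) =
  (a n (k + j) - a n k - (j%:R * d n) *: F (a n k)) + d n *: (F (a n (k + j)) - F (a n k)).
  by rewrite -natr1; lincomb finV.
apply: (le_trans (ler_normD _ _)).
apply: (@le_trans _ _ (K ^+ 2 * (j%:R * d n) ^+ 2 + d n * (K * (K * (j%:R * d n))))).
  apply: lerD => //; rewrite normrZ gtr0_norm// ler_pM2l//.
  apply: (le_trans (FL _ _)); rewrite ?a_in//; [|exact: ltnW|].
    by apply: leq_trans (ltnW kn); exact: leq_addr.
  by rewrite ler_pM2l// a_lip// ltnW.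
rewrite -natr1 -subr_ge0.
rewrite [X in 0 <= X](_ : _ = K ^+ 2 * d n ^+ 2 * (1 + j%:R)); last by ring.
by apply: mulr_ge0; [apply: mulr_ge0; exact: sqr_ge0|exact: addr_ge0].
Qed.

(** Two steps of the finer grid differ from one coarse step by [K ^+ 2 * d n ^+ 2], which is
    [a_quad] for two steps; the coarse step is (1 + K d)-Lipschitz, so Gronwall sums these defects
    to O(d). *)
Let a_refine n k : (k <= 2 ^ n)%N ->
  `|a n.+1 (2 * k) - a n k| <= expR (K * H) * (H * K ^+ 2) * d n.
Proof.
move=> kn.
have H1 j : (j < k)%N -> `|a n.+1 (2 * j.+1) - a n j.+1| <=
    (1 + K * d n) * `|a n.+1 (2 * j) - a n j| + K ^+ 2 * d n ^+ 2.
  move=> jk; have jn : (j < 2 ^ n)%N by exact: leq_trans kn.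
  have jn' : (2 * j + 2 <= 2 ^ n.+1)%N
    by rewrite -[X in (_ + X)%N]muln1 -mulnDr expnS leq_mul2l/= addn1.
  have := a_quad jn'; rewrite (_ : 2 * j + 2 = 2 * j.+1)%N; last by rewrite mulnS addnC.
  have -> : 2%:R * d n.+1 = d n by rewrite dS mulrC divfK.
  set p := a n.+1 (2 * j)%N; set p' := a n.+1 (2 * j.+1)%N.
  rewrite [a n j.+1]/(step _ (a n j)) /step; set p0 := a n j => Hp.
  have -> : p' - (p0 + d n *: F p0) =
    (p' - p - d n *: F p) + ((p - p0) + d n *: (F p - F p0)).
    by lincomb finV.
  apply: (le_trans (ler_normD _ _)); rewrite addrC lerD//.
  apply: (le_trans (ler_normD _ _)); rewrite mulrDl mul1r lerD2l.
  apply: (@le_trans _ _ (d n * (K * `|p - p0|))); last by rewrite mulrCA mulrA.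
  rewrite normrZ gtr0_norm// ler_pM2l//; apply: FL.
    by apply: a_in; exact: ltnW.
  by apply: a_in; apply: leq_trans jn'; exact: leq_addr.
have Kd : 0 <= K * d n by rewrite mulr_ge0 ?ltW.
have := discrete_gronwall Kd _ _ H1.
rewrite muln0 subrr normr0 add0r => /(_ _ (lexx _)) /le_trans; apply.
  by rewrite mulr_ge0 ?sqr_ge0.
rewrite -[leRHS]mulrA; apply: ler_pM; rewrite ?expR_ge0//.
- by apply: mulr_ge0 => //; apply: mulr_ge0; exact: sqr_ge0.
- rewrite ler_expR; have -> : K * d n * k%:R = K * (k%:R * d n) by ring.
  by rewrite ler_pM2l// grid_le.
have -> : k%:R * (K ^+ 2 * d n ^+ 2) = (k%:R * d n) * (K ^+ 2 * d n) by ring.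
rewrite -[leRHS]mulrA ler_wpM2r ?grid_le//.
by apply: mulr_ge0; [exact: sqr_ge0|exact: ltW].
Qed.

Let trunc_bounds n t : 0 <= t <= H ->
  [/\ (Num.truncn (t / d n) <= 2 ^ n)%N, (Num.truncn (t / d n))%:R * d n <= t &
      t < (Num.truncn (t / d n)).+1%:R * d n].
Proof.
move=> /andP[t0 tH].
have td0 : 0 <= t / d n by rewrite divr_ge0// ltW.
have /andP[l1 l2] := truncn_itv td0.
have l1' : (Num.truncn (t / d n))%:R * d n <= t by rewrite -ler_pdivlMr.
split=> //; last by rewrite -ltr_pdivrMr.
rewrite -(ler_nat R) -(ler_pM2r (d_gt0 n)) d_total; exact: le_trans tH.
Qed.

(** The node to the left of [t] on the finer grid has index 2k or 2k+1 when the coarse one has index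
    k, so at most one extra fine step adds to [a_refine]. *)
Let E_refine n t : 0 <= t <= H ->
  `|E n.+1 t - E n t| <= (expR (K * H) * (H * K ^+ 2) * H + K * H) * 2^-1 ^+ n.
Proof.
move=> tH; have [k1 k2 k3] := trunc_bounds n tH; have [l1 l2 l3] := trunc_bounds n.+1 tH.
rewrite /E; set k := Num.truncn (t / d n) in k1 k2 k3 *.
set l := Num.truncn (t / d n.+1) in l1 l2 l3 *.
have dd : 2 * d n.+1 = d n by rewrite dS mulrC divfK.
have kl : (2 * k <= l)%N.
  rewrite -ltnS -(ltr_nat R) -(ltr_pM2r (d_gt0 n.+1)).
  by apply: le_lt_trans l3; rewrite natrM mulrAC mulrC dd.
have lk : (l <= 2 * k + 1)%N.
  rewrite -ltnS -(ltr_nat R) -(ltr_pM2r (d_gt0 n.+1)).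
  apply: (le_lt_trans l2); apply: (lt_le_trans k3).
  by rewrite -dd mulrCA mulrA -natrM ler_pM2r// ler_nat mulnS addn1.
rewrite -(subnKC kl) in l1 *; set j := (l - 2 * k)%N in l1 *.
have j1 : (j <= 1)%N by rewrite leq_subLR.
have -> : a n.+1 (2 * k + j) - a n k =
  (a n.+1 (2 * k + j) - a n.+1 (2 * k)) + (a n.+1 (2 * k) - a n k) by rewrite addrA subrK.
apply: (le_trans (ler_normD _ _)); rewrite mulrDl addrC lerD//.
  by apply: (le_trans (a_refine k1)); rewrite /d mulrA.
apply: (le_trans (a_lip l1)); rewrite -mulrA ler_pM2l//.
apply: (@le_trans _ _ (1 * d n.+1)); first by rewrite ler_pM2r// (ler_nat _ _ 1).
by rewrite mul1r -[leRHS]/(d n) -dd mulr_natl mulr2n lerDl ltW.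
Qed.

(** Both occurrences of [d n] come from rounding [s] and [t] down to the grid, which alters [t - s]
    by at most one step. *)
Let E_quad n s t : 0 <= s -> s <= t -> t <= H ->
  `|E n t - E n s - (t - s) *: F (E n s)| <=
    K ^+ 2 * (t - s + d n) ^+ 2 + K * d n.
Proof.
move=> s0 st tH.
have sH : 0 <= s <= H by rewrite s0 (le_trans st).
have tH' : 0 <= t <= H by rewrite tH (le_trans s0).
have [k1 k2 k3] := trunc_bounds n sH; have [l1 l2 l3] := trunc_bounds n tH'.
rewrite /E; set k := Num.truncn (s / d n) in k1 k2 k3 *.
set l := Num.truncn (t / d n) in l1 l2 l3 *.
have kl : (k <= l)%N.
  rewrite -ltnS -(ltr_nat R) -(ltr_pM2r (d_gt0 n)); apply: le_lt_trans l3.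
  exact: le_trans st.
have jE : (l - k)%:R * d n = l%:R * d n - k%:R * d n by rewrite natrB// mulrBl.
have j1 : (l - k)%:R * d n <= t - s + d n.
  by rewrite jE; move: k3; rewrite -natr1 mulrDl mul1r; lra.
have j2 : `|(l - k)%:R * d n - (t - s)| <= d n.
  rewrite jE ler_norml; move: k3 l3; rewrite -!natr1 !mulrDl !mul1r => *; apply/andP; split; lra.
rewrite -{1}(subnKC kl).
have -> : a n (k + (l - k)) - a n k - (t - s) *: F (a n k) =
  (a n (k + (l - k)) - a n k - ((l - k)%:R * d n) *: F (a n k)) +
  ((l - k)%:R * d n - (t - s)) *: F (a n k).
  by lincomb finV.
apply: (le_trans (ler_normD _ _)); apply: lerD.
  apply: (le_trans (a_quad _)); first by rewrite subnKC.
  have jd0 : 0 <= (l - k)%:R * d n by apply: mulr_ge0 => //; exact: ltW.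
  rewrite ler_wpM2l ?sqr_ge0// lerXn2r// nnegrE; exact: le_trans j1.
by rewrite normrZ mulrC ler_pM// FK// a_in.
Qed.

Lemma euler_flow : exists u : R -> V,
  [/\ u 0 = q, forall t, 0 <= t <= H -> `|u t - c| < r & quadratic_curve F H u].
Proof.
have /choice[u uP] : forall t, exists l : V, 0 <= t <= H -> E n t @[n --> \oo] --> l.
  move=> t; have [tH|] := boolP (0 <= t <= H); last by exists 0.
  by have [l] := geometric_increments_cvg finV (fun n => E_refine n tH); exists l.
have H0' : 0 <= (0 : R) <= H by rewrite lexx ltW.
have dlim : d n @[n --> \oo] --> 0.
  have : geometric H 2^-1 n @[n --> \oo] --> 0.
    by apply: cvg_geometric; rewrite ger0_norm// invf_lt1// ltr1n.
  exact.
have u_in t : 0 <= t <= H -> `|u t - c| < r.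
  move=> tH; apply: close_in.
  apply: (@ler_cvg_to _ \oo _ _ (fun n => `|E n t - q|) (fun=> K * H)).
  - by apply: cvg_norm; apply: cvgB; [exact: uP|exact: cvg_cst].
  - exact: cvg_cst.
  - near=> n; have [k1 _ _] := trunc_bounds n tH.
    by apply: (le_trans (a_near k1)); rewrite ler_pM2l// grid_le.
have E_in n t : 0 <= t <= H -> `|E n t - c| < r.
  by move=> tH; have [k1 _ _] := trunc_bounds n tH; exact: a_in.
have Flim t : 0 <= t <= H -> F (E n t) @[n --> \oo] --> F (u t).
  move=> tH; apply/cvgrPdist_le => eps eps0.
  have /cvgrPdist_le/(_ (eps / K)) := uP _ tH; rewrite divr_gt0// => /(_ isT).
  apply: filterS => n Hn; apply: (le_trans (FL (E_in n _ tH) (u_in _ tH))).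
  by rewrite mulrC -ler_pdivlMr.
have fwd s t : 0 <= s -> s <= t -> t <= H ->
    `|u t - u s - (t - s) *: F (u s)| <= K ^+ 2 * (t - s) ^+ 2.
  move=> s0 st tH.
  have sH : 0 <= s <= H by rewrite s0 (le_trans st).
  have tH' : 0 <= t <= H by rewrite tH (le_trans s0).
  apply: (@ler_cvg_to _ \oo _ _ (fun n => `|E n t - E n s - (t - s) *: F (E n s)|)
    (fun n => K ^+ 2 * (t - s + d n) ^+ 2 + K * d n)).
  - apply: cvg_norm; apply: cvgB; first by apply: cvgB; exact: uP.
    by apply: cvgZl_tmp; exact: Flim.
  - have tsd : t - s + d n @[n --> \oo] --> t - s.
      by rewrite -[X in _ --> X]addr0; apply: cvgD => //; exact: cvg_cst.
    rewrite -[X in _ --> X]addr0 -(mulr0 K); apply: cvgD.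
      by apply: cvgM; [exact: cvg_cst|apply: cvgM].
    by apply: cvgM => //; exact: cvg_cst.
  - by near=> n; exact: E_quad.
exists u; split => //.
  apply: (@cvg_unique _ (@norm_hausdorff _ V) (E n 0 @[n --> \oo])) (uP _ H0') _.
  have -> : (fun n => E n 0) = cst q by apply/funext => n; rewrite /E mul0r truncn0.
  exact: cvg_cst.
(* Passing to the limit covers only s <= t. For t < s the forward estimate is taken from [t], and
   replacing [F (u t)] by [F (u s)] costs [K] times the Lipschitz constant [K + K ^+ 2 * H] of
   [u]. *)
exists (K ^+ 2 + K * (K + K ^+ 2 * H)) => s t /andP[s0 sH] /andP[t0 tH].
have [st|ts] := leP s t.
  apply: (le_trans (fwd _ _ s0 st tH)); rewrite ler_wpM2r ?sqr_ge0// lerDl.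
  by rewrite !(mulr_ge0, addr_ge0)// ?sqr_ge0// ltW.
have fw := fwd _ _ t0 (ltW ts) sH.
have sH' : 0 <= s <= H by rewrite s0.
have tH' : 0 <= t <= H by rewrite t0.
have st0 : 0 <= s - t by rewrite subr_ge0 ltW.
have K20 : 0 <= K ^+ 2 by exact: sqr_ge0.
have lip : `|u s - u t| <= (K + K ^+ 2 * H) * (s - t).
  have -> : u s - u t = (u s - u t - (s - t) *: F (u t)) + (s - t) *: F (u t).
    by rewrite subrK.
  apply: (le_trans (ler_normD _ _)); rewrite addrC mulrDl lerD//.
    by rewrite normrZ ger0_norm// mulrC ler_wpM2r// FK// u_in.
  apply: (le_trans fw); rewrite -mulrA ler_wpM2l// expr2 ler_wpM2r//.
  by rewrite lerBlDr (le_trans sH)// lerDl.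
have -> : u t - u s - (t - s) *: F (u s) =
  - (u s - u t - (s - t) *: F (u t)) + (s - t) *: (F (u s) - F (u t)).
  by lincomb finV.
apply: (le_trans (ler_normD _ _)); rewrite normrN mulrDl.
have -> : (t - s) ^+ 2 = (s - t) ^+ 2 by ring.
apply: lerD => //; rewrite normrZ ger0_norm//.
apply: (@le_trans _ _ ((s - t) * (K * ((K + K ^+ 2 * H) * (s - t))))).
  rewrite ler_wpM2l//; apply: (le_trans (FL (u_in _ tH') (u_in _ sH'))).
  by rewrite ler_pM2l.
by rewrite le_eqVlt; apply/orP; left; apply/eqP; ring.
Unshelve. all: by end_near. Qed.

End EulerPolygons.

(** * Taylor expansion of integral curves *)

Section Expansions.
Context {R : realType} {V : normedModType R} (finV : fin_dim V).
Implicit Types (F : V -> V) (a q : V) (u : R -> V).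

Definition taylor1 F (h : R) q : V := q + h *: F q.

Definition taylor2 F (h : R) q : V :=
  q + h *: F q + (h ^+ 2 / 2) *: 'd F q (F q).

Lemma quadratic_curve_pos F H u : quadratic_curve F H u ->
  exists2 C : R, 0 <= C & forall s t, 0 <= s -> s <= t -> t <= H ->
    `|u t - u s - (t - s) *: F (u s)| <= C * (t - s) ^+ 2.
Proof.
move=> [C CP]; exists `|C| => // s t s0 st tH.
apply: (le_trans (CP _ _ _ _)).
- by rewrite s0 (le_trans st).
- by rewrite tH (le_trans s0).
- by rewrite ler_wpM2r ?sqr_ge0// ler_norm.
Qed.

Section Curve.
Context F u (a : V) (r h : R).
Context (r0 : 0 < r) (Fr : C11_ball F a r) (h0 : 0 <= h).
Context (uq : quadratic_curve F h u)
  (u_in : forall t, 0 <= t <= h -> `|u t - a| < r).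

Let K := r^-1.
Let q := u 0.

Let q_in : `|q - a| < r.
Proof. by apply: u_in; rewrite lexx. Qed.

Let K0 : 0 <= K.
Proof. by rewrite invr_ge0 ltW. Qed.

Lemma curve_increment s : 0 <= s -> s <= h -> `|u s - u 0| <= K * s.
Proof.
move=> s0 sh; have [C C0 CP] := quadratic_curve_pos uq.
apply: (@increment_le _ _ u s K C) => // t t' t0 tt' t's.
have t'h := le_trans t's sh.
have -> : u t' - u t = (t' - t) *: F (u t) + (u t' - u t - (t' - t) *: F (u t)).
  by lincomb finV.
apply: (le_trans (ler_normD _ _)); apply: lerD; last exact: CP.
rewrite normrZ ger0_norm ?subr_ge0// mulrC ler_wpM2r ?subr_ge0//.
have uti : `|u t - a| < r by apply: u_in; rewrite t0 (le_trans tt').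
by have [] := Fr uti uti.
Qed.

Let F_increment s : 0 <= s -> s <= h -> `|F (u s) - F q| <= K ^+ 2 * s.
Proof.
move=> s0 sh; have us : `|u s - a| < r by apply: u_in; rewrite s0.
have [_ + _ _ _] := Fr q_in us; move=> /le_trans; apply.
by rewrite expr2 -mulrA ler_wpM2l// curve_increment.
Qed.

(** The curve [u t - t *: F q] has velocity F(u t) - F(q), of norm at most K^2 s on [0,s].
    Intermediate times [s] are allowed because the second-order expansion needs them. *)
Let expansion1 s : 0 <= s -> s <= h -> `|u s - taylor1 F s q| <= K ^+ 2 * s ^+ 2.
Proof.
move=> s0 sh; have [C C0 CP] := quadratic_curve_pos uq.
have -> : u s - taylor1 F s q = (u s - s *: F q) - (u 0 - (0 : R) *: F q).
  by rewrite /taylor1 -/q; lincomb finV.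
rewrite [s ^+ 2]expr2 mulrA.
apply: (@increment_le _ _ (fun s => u s - s *: F q) s _ C) => // t t' t0 tt' t's.
have t'h := le_trans t's sh.
have -> : u t' - t' *: F q - (u t - t *: F q) =
  (t' - t) *: (F (u t) - F q) + (u t' - u t - (t' - t) *: F (u t)).
  by lincomb finV.
apply: (le_trans (ler_normD _ _)); apply: lerD; last exact: CP.
rewrite normrZ ger0_norm ?subr_ge0// mulrC ler_wpM2r ?subr_ge0//.
apply: (le_trans (F_increment t0 (le_trans tt' t'h))).
by rewrite ler_wpM2l ?sqr_ge0// (le_trans tt').
Qed.

Lemma curve_expansion1 : `|u h - taylor1 F h q| <= K ^+ 2 * h ^+ 2.
Proof. exact: expansion1. Qed.

(** The velocity of [G] at [t] is F(u t) - F(q) - t F'(q)F(q). It splits into the Taylor remainder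
    of F, at most K (K t)^2, and F'(q) applied to the first-order error, at most K K^2 t^2: hence
    the constant 2 K^3. *)
Lemma curve_expansion2 : `|u h - taylor2 F h q| <= 2 * K ^+ 3 * h ^+ 3.
Proof.
have [C C0 CP] := quadratic_curve_pos uq.
pose A := 'd F q (F q).
pose G s := u s - s *: F q - (s ^+ 2 / 2) *: A.
have -> : u h - taylor2 F h q = G h - G 0.
  by rewrite /taylor2 /G -/A -/q; lincomb finV.
have -> : 2 * K ^+ 3 * h ^+ 3 = 2 * K ^+ 3 * h ^+ 2 * h by ring.
apply: (@increment_le _ _ G h _ (C + `|A|)) => //; first exact: addr_ge0.
move=> t t' t0 tt' t'h; have th := le_trans tt' t'h.
have d0 : 0 <= t' - t by rewrite subr_ge0.
have -> : G t' - G t = (t' - t) *: (F (u t) - F q - t *: A) +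
   ((u t' - u t - (t' - t) *: F (u t)) - ((t' - t) ^+ 2 / 2) *: A).
  by rewrite /G; lincomb finV.
apply: (le_trans (ler_normD _ _)); apply: lerD.
  rewrite normrZ ger0_norm// mulrC ler_wpM2r//.
  have ut : `|u t - a| < r by apply: u_in; rewrite t0.
  have [_ _ f3 f4 _] := Fr q_in ut.
  have -> : F (u t) - F q - t *: A =
    (F (u t) - F q - 'd F q (u t - q)) + 'd F q (u t - taylor1 F t q).
    have -> : u t - taylor1 F t q = (u t - q) - t *: F q by rewrite /taylor1; lincomb finV.
    have dE : 'd F q (u t - q - t *: F q) = 'd F q (u t - q) - t *: A.
      by rewrite linearB; congr (_ - _); rewrite linearZ.
    by rewrite dE; lincomb finV.
  apply: (le_trans (ler_normD _ _)).
  apply: (@le_trans _ _ (K ^+ 3 * t ^+ 2 + K ^+ 3 * t ^+ 2)).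
    apply: lerD.
      apply: (le_trans f3); have -> : K ^+ 3 * t ^+ 2 = K * (K * t) ^+ 2 by ring.
      rewrite ler_wpM2l// lerXn2r// ?nnegrE//.
        exact: mulr_ge0.
      exact: curve_increment.
    apply: (le_trans (f4 _)); have -> : K ^+ 3 * t ^+ 2 = K * (K ^+ 2 * t ^+ 2) by ring.
    rewrite ler_wpM2l//.
    exact: expansion1.
  have -> : K ^+ 3 * t ^+ 2 + K ^+ 3 * t ^+ 2 = 2 * K ^+ 3 * t ^+ 2 by ring.
  rewrite ler_wpM2l// ?lerXn2r// ?nnegrE//.
  by apply: mulr_ge0 => //; exact: exprn_ge0.
apply: (le_trans (ler_normB _ _)); rewrite mulrDl; apply: lerD; first exact: CP.
rewrite normrZ mulrC ler_wpM2l// ger0_norm ?divr_ge0 ?sqr_ge0//.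
by rewrite ler_pdivrMr// ler_peMr ?sqr_ge0// ler1n.
Qed.

End Curve.
End Expansions.

(** * One-step maps and splitting *)

Section Steps.
Context {R : realType} {V : normedModType R} (finV : fin_dim V).
Implicit Types (F : V -> V) (a q : V) (A Z : set V) (G Phi : R -> V -> V).

(* A stands for the trajectory and Z for the consistent states. *)
Definition step_bound A Z G (p : nat) Phi (C delta : R) : Prop :=
  forall a q h, A a -> Z q -> `|q - a| < delta -> 0 < h -> h <= delta ->
    [/\ Z (Phi h q), `|Phi h q - q| <= C * h &
        `|Phi h q - G h q| <= C * h ^+ p.+1].

Definition step_approx A Z G p Phi : Prop :=
  exists C delta, [/\ 0 < C, 0 < delta & step_bound A Z G p Phi C delta].

Lemma step_boundW A Z G p Phi C C' delta delta' : C <= C' -> delta' <= delta ->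
  step_bound A Z G p Phi C delta -> step_bound A Z G p Phi C' delta'.
Proof.
move=> CC' dd' H a q h Aa Zq qa h0 hd.
have [H1 H2 H3] := H a q h Aa Zq (lt_le_trans qa dd') h0 (le_trans hd dd').
split=> //; first by apply: (le_trans H2); rewrite ler_pM2r.
by apply: (le_trans H3); rewrite ler_pM2r// exprn_gt0.
Qed.

(** Half steps are re-indexed by the full [h], so that all three substeps of Strang splitting are
    estimated in the same variable; halving only shrinks the errors. *)
Lemma half_step_bound A Z G p Phi C delta : 0 < C ->
  step_bound A Z G p Phi C delta ->
  step_bound A Z (fun h => G (h / 2)) p (fun h => Phi (h / 2)) C delta.
Proof.
move=> C0 H a q h Aa Zq qa h0 hd.
have h20 : 0 < h / 2 by rewrite divr_gt0.
have h2h : h / 2 <= h by rewrite ler_pdivrMr// ler_peMr ?ler1n// ltW.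
have [H1 H2 H3] := H a q (h / 2) Aa Zq qa h20 (le_trans h2h hd).
split=> //; first by apply: (le_trans H2); rewrite ler_pM2l.
by apply: (le_trans H3); rewrite ler_pM2l// lerXn2r// ?nnegrE ltW.
Qed.

(* The last inequality leaves room for two consecutive steps. *)
Lemma common_step_bound A Z G1 G2 G3 p Phi1 Phi2 Phi3 r : 0 < r ->
  step_approx A Z G1 p Phi1 -> step_approx A Z G2 p Phi2 ->
  step_approx A Z G3 p Phi3 ->
  exists C delta0 delta, [/\ 0 < C, 0 < delta,
    [/\ delta <= delta0, delta0 <= 1 & delta0 <= r],
    delta + 2 * C * delta <= delta0 &
    [/\ step_bound A Z G1 p Phi1 C delta0,
        step_bound A Z G2 p Phi2 C delta0 &
        step_bound A Z G3 p Phi3 C delta0]].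
Proof.
move=> r0 [C1 [d1 [C10 d10 H1]]] [C2 [d2 [C20 d20 H2]]] [C3 [d3 [C30 d30 H3]]].
pose C := C1 + C2 + C3.
pose d0 := Num.min (Num.min d1 (Num.min d2 d3)) (Num.min 1 r).
have C0 : 0 < C by rewrite !addr_gt0.
have d00 : 0 < d0 by rewrite !lt_min d10 d20 d30 ltr01 r0.
have C20' : 0 < 1 + 2 * C by rewrite addr_gt0// mulr_gt0.
exists C, d0, (d0 / (1 + 2 * C)); split => //.
- by rewrite divr_gt0.
- split; try by rewrite /d0 !ge_min lexx ?orbT.
  by rewrite ler_pdivrMr// ler_peMr ?(ltW d00)// lerDl mulr_ge0// ltW.
- by rewrite -[X in X + _]mul1r -mulrDl mulrC divfK// gt_eqF.
- split; [apply: step_boundW H1|apply: step_boundW H2|apply: step_boundW H3];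
    rewrite ?/d0 ?ge_min ?lexx ?orbT// /C; lra.
Qed.

Lemma near_after_step a q q' (delta delta0 C h : R) (m : nat) : 0 < C ->
  (m <= 2)%N -> 0 < h -> h <= delta ->
  delta + 2 * C * delta <= delta0 -> `|q - a| < delta ->
  `|q' - q| <= m%:R * C * h -> `|q' - a| < delta0.
Proof.
move=> C0 m2 h0 hd dd qa qq'; apply: lt_le_trans dd.
have -> : q' - a = (q - a) + (q' - q) by lincomb finV.
apply: (le_lt_trans (ler_normD _ _)); apply: ltr_leD => //.
apply: (le_trans qq'); rewrite -!mulrA; apply: ler_pM => //.
- by apply: mulr_ge0; exact: ltW.
- by rewrite (ler_nat _ _ 2).
- by rewrite ler_pM2l.
Qed.

(** Besides the two local errors, the only defect is that F2 is evaluated at [q1] instead of [q]. As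
    [q1] is within [C * h] of [q], this costs [K * C * h ^+ 2]. *)
Lemma lie_trotter_approx A Z F1 F2 F Phi1 Phi2 r : 0 < r ->
  (forall a, A a -> C11_ball F1 a r) -> (forall a, A a -> C11_ball F2 a r) ->
  (forall q, F q = F1 q + F2 q) ->
  step_approx A Z (taylor1 F1) 1 Phi1 -> step_approx A Z (taylor1 F2) 1 Phi2 ->
  step_approx A Z (taylor1 F) 1 (lie_trotter Phi1 Phi2).
Proof.
move=> r0 F1r F2r FE s1 s2.
have [C [d0 [d [C0 d_gt0 [dd0 d01 d0r] dd [H1 H2 _]]]]] :=
  common_step_bound r0 s1 s2 s1.
pose K := r^-1; have K0 : 0 < K by rewrite invr_gt0.
exists (2 * C + K * C), d; split => //; first by rewrite addr_gt0 ?mulr_gt0.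
move=> a q h Aa Zq qa h0 hd; have hd0 := le_trans hd dd0.
have qa0 : `|q - a| < d0 by exact: lt_le_trans dd0.
have [Zq1 q1q q1T] := H1 a q h Aa Zq qa0 h0 hd0.
rewrite /lie_trotter; set q1 := Phi1 h q in Zq1 q1q q1T *.
have q1a : `|q1 - a| < d0.
  by apply: (near_after_step (m := 1) C0 _ h0 hd dd qa); rewrite ?mul1r.
have [Zq2 q2q q2T] := H2 a q1 h Aa Zq1 q1a h0 hd0.
set q2 := Phi2 h q1 in Zq2 q2q q2T *.
have h1 : h <= 1 by exact: le_trans hd0 d01.
split => //.
  have -> : q2 - q = (q2 - q1) + (q1 - q) by lincomb finV.
  apply: (le_trans (ler_normD _ _)); apply: (le_trans (lerD q2q q1q)).
  have : 0 <= K * C * h by rewrite !mulr_ge0// ltW.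
  by rewrite mulrDl; lra.
have -> : q2 - taylor1 F h q =
  (q2 - taylor1 F2 h q1) + (q1 - taylor1 F1 h q) + h *: (F2 q1 - F2 q).
  by rewrite /taylor1 FE; lincomb finV.
apply: (le_trans (ler_normD _ _)); rewrite [leRHS]mulrDl; apply: lerD.
  by apply: (le_trans (ler_normD _ _)); have := lerD q2T q1T; lra.
rewrite normrZ gtr0_norm//.
have [_ f2 _ _ _] := F2r a Aa _ _ (lt_le_trans qa0 d0r) (lt_le_trans q1a d0r).
apply: (@le_trans _ _ (h * (K * (C * h)))).
  by rewrite ler_pM2l// (le_trans f2)// ler_pM2l.
by have -> : h * (K * (C * h)) = K * C * h ^+ 2 by ring.
Qed.

(** Re-expands at [q] a step taken from [q'], where [v] is the leading part of [q' - q]. The three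
    constants come from the Taylor remainder of F, from replacing [q' - q] by [v] inside F'(q), and
    from moving the base point of the second-order term. *)
Lemma taylor2_shift F a r q q' v (D s h : R) : 0 < r -> C11_ball F a r ->
  `|q - a| < r -> `|q' - a| < r -> 0 <= D -> 0 <= s -> s <= h ->
  `|q' - q| <= D * h -> `|q' - q - v| <= D * h ^+ 2 ->
  `|taylor2 F s q' - (q' + s *: F q + s *: 'd F q v + (s ^+ 2 / 2) *: 'd F q (F q))|
    <= (r^-1 * D ^+ 2 + r^-1 * D + r^-1 ^+ 2 * D) * h ^+ 3.
Proof.
move=> r0 Fr qr q'r D0 s0 sh qq' qq'v.
pose K := r^-1; have K0 : 0 <= K by rewrite invr_ge0 ltW.
have h0 := le_trans s0 sh.
have [f1 f2 f3 f4 f5] := Fr _ _ qr q'r.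
have [_ _ _ g4 _] := Fr _ _ q'r qr.
have Dh : 0 <= D * h by exact: mulr_ge0.
have -> : taylor2 F s q' -
    (q' + s *: F q + s *: 'd F q v + (s ^+ 2 / 2) *: 'd F q (F q)) =
  s *: (F q' - F q - 'd F q (q' - q)) + s *: 'd F q (q' - q - v) +
  (s ^+ 2 / 2) *: ('d F q' (F q' - F q) + ('d F q' (F q) - 'd F q (F q))).
  have -> : 'd F q (q' - q - v) = 'd F q (q' - q) - 'd F q v by rewrite linearB.
  rewrite ['d F q' (F q' - F q)]linearB /taylor2; lincomb finV.
apply: (le_trans (ler_normD _ _)); rewrite mulrDl; apply: lerD.
  apply: (le_trans (ler_normD _ _)); rewrite mulrDl !normrZ (ger0_norm s0).
  apply: lerD.
    have -> : r^-1 * D ^+ 2 * h ^+ 3 = h * (K * (D * h) ^+ 2) by rewrite /K; ring.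
    apply: ler_pM => //; apply: (le_trans f3); rewrite ler_wpM2l//.
    by rewrite lerXn2r// nnegrE.
  have -> : r^-1 * D * h ^+ 3 = h * (K * (D * h ^+ 2)) by rewrite /K; ring.
  by apply: ler_pM => //; apply: (le_trans (f4 _)); rewrite ler_wpM2l.
rewrite normrZ ger0_norm ?divr_ge0 ?sqr_ge0//.
have -> : r^-1 ^+ 2 * D * h ^+ 3 = h ^+ 2 / 2 * (K * (K * (D * h)) + K * (D * h) * K).
  by rewrite /K; field; rewrite gt_eqF.
apply: ler_pM; rewrite ?divr_ge0 ?sqr_ge0//.
  by rewrite ler_pM2r// lerXn2r.
apply: (le_trans (ler_normD _ _)); apply: lerD.
  by apply: (le_trans (g4 _)); rewrite ler_wpM2l// (le_trans f2)// ler_wpM2l.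
apply: (le_trans (f5 _)); apply: ler_pM => //; first exact: mulr_ge0.
by rewrite ler_wpM2l.
Qed.

(** Symmetry makes the second-order terms match. F1'F1 collects h^2/8 from each half step and h^2/4
    from re-expanding the last one; F2'F1 gets h^2/2 from the shift of the middle step, F1'F2 gets
    h^2/2 from that of the last, and F2'F2 has h^2/2 directly. The sum is h^2/2 (F1+F2)'(F1+F2). *)
Lemma strang_approx A Z F1 F2 F Phi1 Phi2 Phi3 r : 0 < r ->
  (forall a, A a -> C11_ball F1 a r) -> (forall a, A a -> C11_ball F2 a r) ->
  (forall q, F q = F1 q + F2 q) ->
  (forall a q, A a -> `|q - a| < r ->
     forall v, 'd F q v = 'd F1 q v + 'd F2 q v) ->
  step_approx A Z (taylor2 F1) 2 Phi1 -> step_approx A Z (taylor2 F2) 2 Phi2 ->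
  step_approx A Z (taylor2 F1) 2 Phi3 ->
  step_approx A Z (taylor2 F) 2 (strang Phi1 Phi2 Phi3).
Proof.
move=> r0 F1r F2r FE dFE s1 s2 s3.
have [C [d0 [d [C0 d_gt0 [dd0 d01 d0r] dd [H1' H2 H3']]]]] :=
  common_step_bound r0 s1 s2 s3.
have H1 := half_step_bound C0 H1'; have H3 := half_step_bound C0 H3'.
pose K := r^-1; have K0 : 0 < K by rewrite invr_gt0.
(* [D] bounds both the displacements [q1 - q], [q2 - q] over h and the deviation from their leading
   parts over h^2; it is the sum of the four contributions to [w2]. [E] is the constant that
   [taylor2_shift] yields for this [D]. *)
pose D := 2 * C + 2 * K ^+ 2 + K * C.
have K20 : 0 <= K ^+ 2 by exact: sqr_ge0.
have KC0 : 0 <= K * C by rewrite mulr_ge0// ltW.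
have D0 : 0 < D by rewrite /D; lra.
pose E := K * D ^+ 2 + K * D + K ^+ 2 * D.
have E0 : 0 <= E by rewrite /E !addr_ge0// !mulr_ge0// ?sqr_ge0// ltW.
exists (3 * C + 2 * E), d; split => //; first by lra.
move=> a q h Aa Zq qa h0 hd; have hd0 := le_trans hd dd0.
have h1 : h <= 1 by exact: le_trans hd0 d01.
have h20 : 0 <= h ^+ 2 by exact: sqr_ge0.
have h30 : 0 <= h ^+ 3 by rewrite exprn_ge0 ?ltW.
have h32 : h ^+ 3 <= h ^+ 2 by rewrite exprS ler_piMl.
have hh : 0 <= h / 2 /\ h / 2 <= h by lra.
have qa0 : `|q - a| < d0 by exact: lt_le_trans dd0.
have [Zq1 q1q q1T] := H1 a q h Aa Zq qa0 h0 hd0.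
rewrite /strang; set q1 := Phi1 (h / 2) q in Zq1 q1q q1T *.
have q1a : `|q1 - a| < d0.
  by apply: (near_after_step (m := 1) C0 _ h0 hd dd qa); rewrite ?mul1r.
have [Zq2 q2q1 q2T] := H2 a q1 h Aa Zq1 q1a h0 hd0.
set q2 := Phi2 h q1 in Zq2 q2q1 q2T *.
have q2q : `|q2 - q| <= 2 * C * h.
  have -> : q2 - q = (q2 - q1) + (q1 - q) by lincomb finV.
  by apply: (le_trans (ler_normD _ _)); have := lerD q2q1 q1q; lra.
have q2a : `|q2 - a| < d0 by exact: (near_after_step (m := 2) C0 _ h0 hd dd qa).
have [Zq3 q3q2 q3T] := H3 a q2 h Aa Zq2 q2a h0 hd0.
set q3 := Phi3 (h / 2) q2 in Zq3 q3q2 q3T *.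
have [qr q1r q2r] : [/\ `|q - a| < r, `|q1 - a| < r & `|q2 - a| < r].
  by split; apply: lt_le_trans d0r.
have Eh : 0 <= E * h by rewrite mulr_ge0// ltW.
split => //.
  have -> : q3 - q = (q3 - q2) + (q2 - q) by lincomb finV.
  by apply: (le_trans (ler_normD _ _)); have := lerD q3q2 q2q; rewrite mulrDl; lra.
have [a1 _ _ a4 _] := F1r _ Aa _ _ qr qr.
have [b1 _ _ b4 _] := F2r _ Aa _ _ q1r q1r.
have [_ b2 _ _ _] := F2r _ Aa _ _ qr q1r.
have w1 : `|q1 - q - (h / 2) *: F1 q| <= (C + K ^+ 2) * h ^+ 2.
  have -> : q1 - q - (h / 2) *: F1 q =
    (q1 - taylor2 F1 (h / 2) q) + ((h / 2) ^+ 2 / 2) *: 'd F1 q (F1 q).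
    by rewrite /taylor2; lincomb finV.
  apply: (le_trans (ler_normD _ _)); rewrite mulrDl; apply: lerD.
    by apply: (le_trans q1T); rewrite ler_pM2l.
  rewrite normrZ mulrC ger0_norm ?divr_ge0 ?sqr_ge0//; apply: ler_pM => //.
  - by rewrite divr_ge0 ?sqr_ge0.
  - by apply: (le_trans (a4 _)); rewrite expr2 ler_pM2l.
  - by rewrite exprMn; lra.
have w2 : `|q2 - q - ((h / 2) *: F1 q + h *: F2 q)| <= D * h ^+ 2.
  have -> : q2 - q - ((h / 2) *: F1 q + h *: F2 q) =
    (q1 - q - (h / 2) *: F1 q) + (q2 - taylor2 F2 h q1) +
    (h *: (F2 q1 - F2 q) + (h ^+ 2 / 2) *: 'd F2 q1 (F2 q1)).
    by rewrite /taylor2; lincomb finV.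
  have e1 : `|q2 - taylor2 F2 h q1| <= C * h ^+ 2.
    by apply: (le_trans q2T); rewrite ler_pM2l.
  have e2 : `|h *: (F2 q1 - F2 q)| <= K * C * h ^+ 2.
    rewrite normrZ gtr0_norm//.
    have -> : K * C * h ^+ 2 = h * (K * (C * h)) by ring.
    by rewrite ler_pM2l// (le_trans b2)// ler_pM2l.
  have e3 : `|(h ^+ 2 / 2) *: 'd F2 q1 (F2 q1)| <= K ^+ 2 * h ^+ 2.
    rewrite normrZ mulrC ger0_norm ?divr_ge0//; apply: ler_pM => //.
    - by rewrite divr_ge0.
    - by apply: (le_trans (b4 _)); rewrite expr2 ler_pM2l.
    - by lra.
  apply: (le_trans (ler_normD _ _)); apply: (le_trans (lerD (ler_normD _ _) (ler_normD _ _))).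
  apply: (le_trans (lerD (lerD w1 e1) (lerD e2 e3))).
  by rewrite le_eqVlt; apply/orP; left; apply/eqP; rewrite /D; ring.
have CD : C <= D by rewrite /D; lra.
have CD2 : 2 * C <= D by rewrite /D; lra.
have w1' : `|q1 - q - (h / 2) *: F1 q| <= D * h ^+ 2.
  by apply: (le_trans w1); rewrite ler_wpM2r// /D; lra.
have q1q' : `|q1 - q| <= D * h by apply: (le_trans q1q); rewrite ler_pM2r.
have q2q' : `|q2 - q| <= D * h by apply: (le_trans q2q); rewrite ler_pM2r.
have S1 := taylor2_shift r0 (F2r _ Aa) qr q1r (ltW D0) (ltW h0) (lexx h) q1q' w1'.
have S2 := taylor2_shift r0 (F1r _ Aa) qr q2r (ltW D0) hh.1 hh.2 q2q' w2.
move: S1 S2; rewrite -/K -/E.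
set S1 := (X in `|taylor2 F2 h q1 - X|); set S2 := (X in `|taylor2 F1 (h / 2) q2 - X|).
move=> HS1 HS2.
have -> : q3 - taylor2 F h q = (q3 - taylor2 F1 (h / 2) q2) +
  (q2 - taylor2 F2 h q1) + (q1 - taylor2 F1 (h / 2) q) +
  ((taylor2 F1 (h / 2) q2 - S2) + (taylor2 F2 h q1 - S1)).
  have d1 : 'd F1 q ((h / 2) *: F1 q + h *: F2 q) =
      (h / 2) *: 'd F1 q (F1 q) + h *: 'd F1 q (F2 q).
    by rewrite linearD; congr (_ + _); rewrite linearZ.
  have d2 : 'd F2 q ((h / 2) *: F1 q) = (h / 2) *: 'd F2 q (F1 q) by rewrite linearZ.
  have d3 : 'd F q (F q) = 'd F1 q (F1 q) + 'd F1 q (F2 q) +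
      ('d F2 q (F1 q) + 'd F2 q (F2 q)).
    by rewrite (dFE _ _ Aa qr) FE ['d F1 q (_ + _)]linearD ['d F2 q (_ + _)]linearD.
  rewrite /S1 /S2 d1 d2 {1}/taylor2 d3 FE [taylor2 F1 (h / 2) q]/taylor2.
  by lincomb finV.
apply: (le_trans (ler_normD _ _)); rewrite mulrDl; apply: lerD.
  apply: (le_trans (ler_normD _ _)).
  apply: (le_trans (lerD (ler_normD _ _) (lexx _))).
  by have := lerD (lerD q3T q2T) q1T; lra.
by apply: (le_trans (ler_normD _ _)); have := lerD HS2 HS1; lra.
Qed.

Lemma taylor1_lip F a r q h : 0 < r -> C11_ball F a r -> `|q - a| < r -> 0 <= h ->
  `|taylor1 F h q - taylor1 F h a| <= (1 + r^-1 * h) * `|q - a|.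
Proof.
move=> r0 Fr qr h0.
have ar : `|a - a| < r by rewrite subrr normr0.
have [_ f2 _ _ _] := Fr _ _ ar qr.
have -> : taylor1 F h q - taylor1 F h a = (q - a) + h *: (F q - F a).
  by rewrite /taylor1; lincomb finV.
apply: (le_trans (ler_normD _ _)); rewrite mulrDl mul1r lerD2l.
by rewrite normrZ ger0_norm// [_ * h]mulrC -mulrA ler_wpM2l.
Qed.

Lemma taylor2_lip F a r q h : 0 < r -> C11_ball F a r -> `|q - a| < r ->
  0 <= h -> h <= 1 ->
  `|taylor2 F h q - taylor2 F h a| <= (1 + (r^-1 + r^-1 ^+ 2) * h) * `|q - a|.
Proof.
move=> r0 Fr qr h0 h1; pose K := r^-1.
have K0 : 0 <= K by rewrite invr_ge0 ltW.
have ar : `|a - a| < r by rewrite subrr normr0.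
have [f1 f2 _ _ f5] := Fr _ _ ar qr.
have [_ _ _ g4 _] := Fr _ _ qr qr.
have -> : taylor2 F h q - taylor2 F h a = (taylor1 F h q - taylor1 F h a) +
  (h ^+ 2 / 2) *: ('d F q (F q - F a) + ('d F q (F a) - 'd F a (F a))).
  by rewrite ['d F q (F q - F a)]linearB /taylor1 /taylor2; lincomb finV.
apply: (le_trans (ler_normD _ _)).
apply: (le_trans (lerD (taylor1_lip r0 Fr qr h0) (lexx _))).
have -> : (1 + (r^-1 + r^-1 ^+ 2) * h) * `|q - a| =
  (1 + r^-1 * h) * `|q - a| + r^-1 ^+ 2 * h * `|q - a|.
  by field; rewrite gt_eqF.
apply: lerD => //.
rewrite normrZ ger0_norm ?divr_ge0 ?sqr_ge0//.
have -> : r^-1 ^+ 2 * h * `|q - a| = h / 2 * (K * (K * `|q - a|) + K * `|q - a| * K).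
  by rewrite /K; field; rewrite gt_eqF.
apply: ler_pM; rewrite ?divr_ge0 ?sqr_ge0//.
  by rewrite ler_pM2r// expr2 ler_piMl.
apply: (le_trans (ler_normD _ _)); apply: lerD.
  by apply: (le_trans (g4 _)); rewrite ler_wpM2l.
by apply: (le_trans (f5 _)); rewrite ler_wpM2l// mulr_ge0.
Qed.

(** Both the exact trajectory and the method are compared with [G], whose Lipschitz constant 1 + L h
    propagates the errors; the defects add up to [B = C + C1]. The estimates are available only near
    the trajectory, so the induction carries the final error bound itself. *)
Lemma one_step_convergence (x : R -> V) (T : R) A Z G p Psi (L C delta : R) :
  0 < T -> (0 < p)%N -> (forall t, 0 <= t <= T -> A (x t)) -> Z (x 0) ->
  0 <= L -> 0 <= C -> 0 < delta ->
  (forall a q h, A a -> `|q - a| < delta -> 0 < h -> h <= delta ->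
     `|G h q - G h a| <= (1 + L * h) * `|q - a|) ->
  (forall t h, 0 <= t -> 0 < h -> h <= delta -> t + h <= T ->
     `|x (t + h) - G h (x t)| <= C * h ^+ p.+1) ->
  step_approx A Z G p Psi ->
  exists C' h0, [/\ 0 < C', 0 < h0 & forall N : nat, (0 < N)%N ->
    let h := T / N%:R in h <= h0 -> forall n : nat, (n <= N)%N ->
    `|iter n (Psi h) (x 0) - x (n%:R * h)| <= C' * h ^+ p].
Proof.
move=> T0 p0 xA Zx0 L0 C0 d0 GL xG [C1 [d1 [C10 d10 PsiG]]].
pose B := C + C1; have B0 : 0 < B by rewrite ltr_wpDl.
pose M := expR (L * T) * (T * B).
have M0 : 0 < M by rewrite /M !mulr_gt0// expR_gt0.
(* For h <= 1 and p > 0 the last entry gives M h^p <= M h <= min(delta, d1)/2, so an iterate obeying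
   the claimed bound is still in the tube. *)
pose h0 := Num.min (Num.min delta d1) (Num.min 1 (Num.min delta d1 / (2 * M))).
have dd0 : 0 < Num.min delta d1 by rewrite lt_min d0.
have h00 : 0 < h0 by rewrite !lt_min d0 d10 ltr01 divr_gt0// mulr_gt0.
exists M, h0; split => // N N0 h hh0 n nN.
have N0' : 0 < N%:R :> R by rewrite ltr0n.
have h_gt0 : 0 < h by rewrite divr_gt0.
have Nh : N%:R * h = T by rewrite /h mulrC divfK// gt_eqF.
move: hh0; rewrite !le_min => /andP[/andP[hd hd1] /andP[h1 hM]].
have Mh : M * h ^+ p < Num.min delta d1.
  apply: (@le_lt_trans _ _ (M * h)).
    by rewrite ler_pM2l// -(prednK p0) exprS ler_piMr ?(ltW h_gt0)// exprn_ile1 ?(ltW h_gt0).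
  rewrite -ltr_pdivlMl// mulrC; apply: (le_lt_trans hM).
  have M20 : 0 < 2 * M by exact: mulr_gt0.
  rewrite ltr_pM2l// ltf_pV2 ?posrE//.
  by rewrite mulr_natl mulr2n ltrDl.
pose e k := `|iter k (Psi h) (x 0) - x (k%:R * h)|.
have t_in k : (k <= N)%N -> 0 <= k%:R * h <= T.
  by move=> kN; rewrite mulr_ge0 ?(ltW h_gt0)//= -Nh ler_pM2r// ler_nat.
(* Gronwall is restarted from index 0 at every stage of the induction, so the constant [M] does not
   deteriorate with [m]. *)
suff H m : (m <= N)%N -> forall k, (k <= m)%N -> Z (iter k (Psi h) (x 0)) /\ e k <= M * h ^+ p.
  by have [] := H n nN n (leqnn _).
elim: m => [_ k|m IH mN k].
  rewrite leqn0 => /eqP ->; split => //.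
  by rewrite /e mul0r subrr normr0 mulr_ge0 ?exprn_ge0// ltW.
rewrite leq_eqVlt => /predU1P[->|]; last by rewrite ltnS; apply: IH; exact: ltnW.
have rec j : (j < m.+1)%N -> Z (iter j.+1 (Psi h) (x 0)) /\
    e j.+1 <= (1 + L * h) * e j + B * h ^+ p.+1.
  rewrite ltnS => jm; have [Zj ej] := IH (ltnW mN) _ jm.
  have jN : (j < N)%N by exact: leq_ltn_trans mN.
  have : e j < Num.min delta d1 by exact: le_lt_trans Mh.
  rewrite lt_min => /andP[ejd ejd1].
  have Aj := xA _ (t_in _ (ltnW jN)).
  have [Zj1 _ PG] := PsiG _ _ _ Aj Zj ejd1 h_gt0 hd1.
  split => //; rewrite /e iterS.
  set xj := iter j (Psi h) (x 0) in Zj ej PG ejd *.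
  have tE : j.+1%:R * h = j%:R * h + h by rewrite -natr1 mulrDl mul1r.
  have xGj := xG (j%:R * h) h; rewrite -tE in xGj.
  have {}xGj : `|x (j.+1%:R * h) - G h (x (j%:R * h))| <= C * h ^+ p.+1.
    by apply: xGj => //; [have /andP[] := t_in _ (ltnW jN)|have /andP[] := t_in _ jN].
  have -> : Psi h xj - x (j.+1%:R * h) = (Psi h xj - G h xj) +
     (G h xj - G h (x (j%:R * h))) - (x (j.+1%:R * h) - G h (x (j%:R * h))).
    by lincomb finV.
  apply: (le_trans (ler_normB _ _)); apply: (le_trans (lerD (ler_normD _ _) (lexx _))).
  apply: (le_trans (lerD (lerD PG (GL _ _ _ Aj ejd h_gt0 hd)) xGj)).
  by rewrite /B /e -/xj; lra.
split; first by have [] := rec m (ltnSn _).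
have Lh : 0 <= L * h by rewrite mulr_ge0// ltW.
have Bh : 0 <= B * h ^+ p.+1 by rewrite mulr_ge0 ?exprn_ge0// ltW.
have := @discrete_gronwall _ e (L * h) (B * h ^+ p.+1) m.+1 Lh Bh (normr_ge0 _)
  (fun j jm => (rec j jm).2).
move=> /le_trans; apply.
rewrite {1}/e mul0r subrr normr0 add0r.
have mT : m.+1%:R * h <= T by rewrite -Nh ler_pM2r// ler_nat.
have -> : M * h ^+ p = expR (L * T) * (T * (B * h ^+ p)) by rewrite /M; ring.
apply: ler_pM; rewrite ?expR_ge0//; first by rewrite mulr_ge0.
  by rewrite ler_expR -mulrA ler_wpM2l// mulrC.
have -> : m.+1%:R * (B * h ^+ p.+1) = (m.+1%:R * h) * (B * h ^+ p) by rewrite exprS; ring.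
by rewrite ler_wpM2r// mulr_ge0 ?exprn_ge0// ltW.
Qed.

End Steps.

(** * Index reduction *)

Section IndexReduction.
Context {R : realType} {ny1 ny2 nz1 nz2 : nat}.
Context (g1 : dae_state R ny1 ny2 nz1 nz2 -> 'rV[R]_nz1)
        (g2 : dae_state R ny1 ny2 nz1 nz2 -> 'rV[R]_nz2).

Let V := dae_state R ny1 ny2 nz1 nz2.
Let W := 'rV[R]_(nz1 + nz2).

Lemma fin_dim_dae_state : fin_dim V.
Proof. by do !apply: fin_dim_prod; exact: fin_dim_rV. Qed.

Definition constraint (p : V) : W := row_mx (g1 p) (g2 p).

Lemma constraint_eq0 p : constraint p = 0 <-> g1 p = 0 /\ g2 p = 0.
Proof.
split; last by move=> [E1 E2]; rewrite /constraint E1 E2 row_mx0.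
by move=> /eqP; rewrite -row_mx0 => /eqP/eq_row_mx.
Qed.

Definition inject_z (w : W) : V := (0, (lsubmx w, rsubmx w)).

Lemma inject_z_is_linear : linear inject_z.
Proof. by move=> a v w; rewrite /inject_z !linearP; congr pair; rewrite /= scaler0 addr0. Qed.

HB.instance Definition _ := GRing.isLinear.Build R W V _ inject_z inject_z_is_linear.

Lemma inject_z_continuous : continuous inject_z.
Proof. by apply: fin_dim_linear_continuous; exact: fin_dim_rV. Qed.

(** Chain rule along the affine map [gamma], which inserts z while y is fixed and has linear part
    [inject_z]: the Jacobian matrix becomes the differential of the constraint restricted to
    algebraic directions. *)
Lemma mul_constraint_jacobian p (w : W) : differentiable constraint p ->
  w *m constraint_jacobian g1 g2 p = 'd constraint p (inject_z w).
Proof.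
move=> dc; rewrite /constraint_jacobian /jacobian mul_rV_lin1.
pose gamma : W -> V := cst (p.1, 0) + inject_z.
have gE w' : gamma w' = (p.1, (lsubmx w', rsubmx w')).
  by rewrite /gamma fctE /inject_z; congr pair; rewrite ?addr0 ?add0r.
set w0 := row_mx p.2.1 p.2.2.
have g0 : gamma w0 = p.
  by rewrite gE /w0 row_mxKl row_mxKr -!surjective_pairing.
have dz : differentiable inject_z w0.
  by apply: linear_differentiable; exact: inject_z_continuous.
have dzE : 'd inject_z w0 = inject_z :> (W -> V).
  by apply: diff_lin; exact: inject_z_continuous.
have zD : is_diff w0 inject_z inject_z by apply: DiffDef.
have [dg dgE] : is_diff w0 gamma inject_z.
  have [d1 d2] := @is_diffD _ _ _ (cst ((p.1, 0) : V)) inject_z 0 inject_z w0 _ zD.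
  by apply: DiffDef d1 _; rewrite d2 add0r.
have -> : (fun w => row_mx (g1 (p.1, (lsubmx w, rsubmx w))) (g2 (p.1, (lsubmx w, rsubmx w)))) =
    constraint \o gamma.
  by apply/funext => w'; rewrite /= gE.
rewrite diff_comp//; last by rewrite g0.
by rewrite /= g0 dgE.
Qed.

(* The z-component of a lifted field is chosen so that the field is tangent to
   the constraint set: lifted fields generate, on consistent states, exactly the
   flows of the corresponding DAE. *)
Definition lift_z (p : V) (v : V) : V :=
  v - inject_z ('d constraint p v *m invmx (constraint_jacobian g1 g2 p)).

Definition lifted_field (k1 : V -> 'rV[R]_ny1) (k2 : V -> 'rV[R]_ny2) (p : V) : V :=
  lift_z p ((k1 p, k2 p), 0).

Lemma lift_z_is_linear p : linear (lift_z p).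
Proof.
move=> a v w; rewrite /lift_z linearP mulmxDl -scalemxAl linearP.
lincomb fin_dim_dae_state.
Qed.

HB.instance Definition _ p :=
  GRing.isLinear.Build R V V _ (lift_z p) (lift_z_is_linear p).

Lemma lifted_field_y k1 k2 p : (lifted_field k1 k2 p).1 = (k1 p, k2 p).
Proof. by rewrite /lifted_field /lift_z /= subr0. Qed.

(** The algebraic velocity depends linearly on the differential one, so splitting the right-hand
    side splits the motion of z as well. *)
Lemma lifted_fieldD k1 k2 p : lifted_field k1 k2 p =
  lifted_field k1 (fun=> 0) p + lifted_field (fun=> 0) k2 p.
Proof.
rewrite /lifted_field -linearD; congr lift_z.
by congr pair; [congr pair|]; rewrite ?addr0 ?add0r.
Qed.

Context (U : set V) (oU : open U).
Context (g1C : of_class_C 3 U g1) (g2C : of_class_C 3 U g2).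
Context (Jreg : forall p, U p -> constraint_jacobian g1 g2 p \in unitmx).

Lemma constraint_of_class_C : of_class_C 3 U constraint.
Proof.
pose l1 (v : 'rV[R]_nz1) : W := row_mx v 0.
pose l2 (v : 'rV[R]_nz2) : W := row_mx 0 v.
have l1l : linear l1 by move=> a v w; rewrite /l1 scale_row_mx add_row_mx scaler0 addr0.
have l2l : linear l2 by move=> a v w; rewrite /l2 scale_row_mx add_row_mx scaler0 addr0.
pose L1 : {linear 'rV[R]_nz1 -> W} := HB.pack l1 (GRing.isLinear.Build _ _ _ _ l1 l1l).
pose L2 : {linear 'rV[R]_nz2 -> W} := HB.pack l2 (GRing.isLinear.Build _ _ _ _ l2 l2l).
apply: (@of_class_C_eq R _ _ _ U ((L1 \o g1) \+ (L2 \o g2)) _ oU).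
  by move=> p _; rewrite /= /l1 /l2 add_row_mx addr0 add0r.
by apply: (of_class_CD oU); apply: (of_class_C_comp_linear oU) => //;
  apply: fin_dim_linear_continuous; exact: fin_dim_rV.
Qed.

Lemma constraint_differentiable p : U p -> differentiable constraint p.
Proof. by have [dc _] := constraint_of_class_C; exact: dc. Qed.

Lemma lift_z_tangent p v : U p -> 'd constraint p (lift_z p v) = 0.
Proof.
move=> Up; rewrite /lift_z linearB -mul_constraint_jacobian.
  by rewrite mulmxKV ?subrr//; exact: Jreg.
exact: constraint_differentiable.
Qed.

(** The rows of the Jacobian are directional derivatives of the constraint, which costs one order of
    differentiability; the differential is moreover taken in a direction [H p] that depends on the
    point. *)
Lemma lifted_field_of_class_C k1 k2 : of_class_C 2 U k1 -> of_class_C 2 U k2 ->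
  of_class_C 2 U (lifted_field k1 k2).
Proof.
move=> k1C k2C.
pose l1 (v : 'rV[R]_ny1) : V := ((v, 0), 0).
pose l2 (v : 'rV[R]_ny2) : V := ((0, v), 0).
have l1l : linear l1.
  by move=> a v w; rewrite /l1; congr pair; [congr pair|]; rewrite /= ?scaler0 ?addr0.
have l2l : linear l2.
  by move=> a v w; rewrite /l2; congr pair; [congr pair|]; rewrite /= ?scaler0 ?addr0.
pose L1 : {linear 'rV[R]_ny1 -> V} := HB.pack l1 (GRing.isLinear.Build _ _ _ _ l1 l1l).
pose L2 : {linear 'rV[R]_ny2 -> V} := HB.pack l2 (GRing.isLinear.Build _ _ _ _ l2 l2l).
pose H : V -> V := fun p => ((k1 p, k2 p), 0).
have HC : of_class_C 2 U H.
  apply: (@of_class_C_eq R _ _ _ U ((L1 \o k1) \+ (L2 \o k2)) _ oU).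
    move=> p _; rewrite /= /l1 /l2 /H.
    by congr pair; [congr pair|]; rewrite ?addr0 ?add0r.
  by apply: (of_class_CD oU); apply: (of_class_C_comp_linear oU) => //;
    apply: fin_dim_linear_continuous; exact: fin_dim_rV.
have cC := constraint_of_class_C.
pose J := constraint_jacobian g1 g2.
have JC i j : of_class_C 2 U (fun p => J p i j).
  apply: (@of_class_C_eq R _ _ _ U (rV_coord j \o 'D_(inject_z (delta_mx 0 i)) constraint) _ oU).
    move=> p Up /=; rewrite deriveE; last exact: constraint_differentiable.
    rewrite -mul_constraint_jacobian; last exact: constraint_differentiable.
    by rewrite -rowE /rV_coord mxE.
  apply: (of_class_C_comp_linear oU); first exact: coord_continuous.
  by have [_] := cC; apply.
pose Q p : W := 'D_(H p) constraint p *m invmx (J p).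
have QC : of_class_C 2 U Q.
  apply: (of_class_C_coordinates oU (@rV_coordinate_system R (nz1 + nz2))) => j.
  apply: (@of_class_C_eq _ _ _ _ _
    (fun p => \sum_i (rV_coord i ('D_(H p) constraint p) * invmx (J p) i j)) _ oU).
    by move=> p _; rewrite /= /rV_coord mxE.
  apply: (of_class_C_sum _ oU) => i.
  apply: (@of_class_CM _ _ _ _ (rV_coord i \o (fun p => 'D_(H p) constraint p)) _ oU);
    last exact: of_class_C_invmx.
    apply: (of_class_C_comp_linear oU); first exact: coord_continuous.
    apply: (of_class_C_derive oU) => //; first exact: fin_dim_dae_state.
  exact: fin_dim_rV.
apply: (@of_class_C_eq R _ _ _ U (H \+ ((-1 : R) \*: idfun \o (inject_z \o Q))) _ oU).
  move=> p Up; rewrite /= /lifted_field /lift_z /Q deriveE//.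
    by rewrite scaleN1r.
  exact: constraint_differentiable.
apply: (of_class_CD oU HC).
have zC : of_class_C 2 U (inject_z \o Q).
  by apply: (of_class_C_comp_linear oU) QC; exact: inject_z_continuous.
apply: (of_class_C_comp_linear oU _ zC).
by apply: fin_dim_linear_continuous; exact: fin_dim_dae_state.
Qed.

End IndexReduction.

(** * Derivatives relative to a segment *)

Section DerivativeWithin.
Context {R : realType}.
Implicit Types V W : normedModType R.

Lemma is_derive_withinP V (A : set R) (u : R -> V) t l :
  is_derive_within A u t l <->
  forall eps : R, 0 < eps -> exists2 d, 0 < d &
    forall s, A s -> `|s - t| < d -> `|u s - u t - (s - t) *: l| <= eps * `|s - t|.
Proof.
have diffE s : s - t != 0 ->
    `|u s - u t - (s - t) *: l| = `|s - t| * `|l - (s - t)^-1 *: (u s - u t)|.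
  move=> st; rewrite -normrZ scalerBr scalerA divff// scale1r -normrN opprB.
  by [].
split.
- move=> /cvgrPdist_le H eps eps0.
  have /nbhs_normP[d /= d0 dP] := H _ eps0.
  exists d => // s As st.
  have [->|st0] := eqVneq s t; first by rewrite !subrr scale0r subrr !normr0 mulr0.
  rewrite diffE ?subr_eq0// mulrC ler_wpM2r//.
  by apply: dP => //=; rewrite distrC.
- move=> H; apply/cvgrPdist_le => eps eps0.
  have [d d0 dP] := H _ eps0.
  apply/nbhs_normP; exists d => //= s /= st st0 As.
  have st' : `|s - t| < d by rewrite distrC.
  have nz : 0 < `|s - t| by rewrite normr_gt0 subr_eq0.
  by have := dP s As st'; rewrite diffE ?subr_eq0// mulrC ler_pM2r.
Qed.

Lemma within_continuousP V (A : set R) (u : R -> V) :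
  {within A, continuous u} <->
  forall t, A t -> forall eps : R, 0 < eps -> exists2 d, 0 < d &
    forall s, A s -> `|s - t| < d -> `|u s - u t| <= eps.
Proof.
split=> [/subspace_continuousP H t At eps eps0|H].
- have /cvgrPdist_le/(_ _ eps0)/nbhs_normP[d /= d0 dP] := H _ At.
  exists d => // s As st; rewrite distrC; apply: dP => //=; by rewrite distrC.
- apply/subspace_continuousP => t At; apply/cvgrPdist_le => eps eps0.
  have [d d0 dP] := H _ At _ eps0.
  apply/nbhs_normP; exists d => //= s /= st As; rewrite distrC; apply: dP => //.
  by rewrite distrC.
Qed.

Lemma is_derive_within_lipschitz V (A : set R) (u : R -> V) t l :
  is_derive_within A u t l -> exists2 d, 0 < d &
    forall s, A s -> `|s - t| < d -> `|u s - u t| <= (`|l| + 1) * `|s - t|.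
Proof.
move=> /is_derive_withinP/(_ _ ltr01)[d d0 dP]; exists d => // s As st.
rewrite -[u s - u t](subrK ((s - t) *: l)).
apply: (le_trans (ler_normD _ _)); rewrite mulrDl addrC lerD ?dP//.
by rewrite normrZ mulrC.
Qed.

Lemma quadratic_curve_derive V (F : V -> V) H u t : 0 <= t <= H ->
  quadratic_curve F H u -> is_derive_within `[0, H] u t (F (u t)).
Proof.
move=> tH [C CP]; apply/is_derive_withinP => eps eps0.
have C0 : 0 < `|C| + 1 by rewrite ltr_wpDl.
exists (eps / (`|C| + 1)); first exact: divr_gt0.
move=> s; rewrite /= in_itv/= => sH st; apply: (le_trans (CP _ _ tH sH)).
rewrite -real_normK ?num_real// expr2 mulrA ler_wpM2r//.
apply: (@le_trans _ _ ((`|C| + 1) * `|s - t|)).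
  by rewrite ler_wpM2r// (le_trans (ler_norm _))// lerDl.
by rewrite mulrC -ler_pdivlMr// ltW.
Qed.

Lemma quadratic_curve_continuous V (F : V -> V) H u :
  quadratic_curve F H u -> {within `[0, H], continuous u}.
Proof.
move=> uq; apply/within_continuousP => t; rewrite /= in_itv/= => tH eps eps0.
have [d d0 dP] := is_derive_within_lipschitz (quadratic_curve_derive tH uq).
have l0 : 0 < `|F (u t)| + 1 by rewrite ltr_wpDl.
exists (Num.min d (eps / (`|F (u t)| + 1))); first by rewrite lt_min d0 divr_gt0.
move=> s sH; rewrite lt_min => /andP[sd se].
by apply: (le_trans (dP _ sH sd)); rewrite mulrC -ler_pdivlMr// ltW.
Qed.

Lemma is_derive_within_comp_linear V W (A : set R) (u : R -> V)
    (l : {linear V -> W}) t v : continuous l ->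
  is_derive_within A u t v -> is_derive_within A (l \o u) t (l v).
Proof.
move=> lc H; rewrite /is_derive_within.
have -> : (fun s => (s - t)^-1 *: ((l \o u) s - (l \o u) t)) =
    l \o (fun s => (s - t)^-1 *: (u s - u t)).
  by apply/funext => s /=; rewrite linearZ/=; congr (_ *: _); rewrite linearB.
by apply: cvg_comp H _; exact: lc.
Qed.

(** At interior points the relative derivative is an ordinary one, and at the endpoints continuity
    suffices for the mean value theorem. The intermediate time depends on the coordinate, hence the
    formulation for a single form [c]. *)
Lemma coordinate_MVT V (u u' : R -> V) (c : {linear V -> R^o}) (T s t : R) :
  continuous c ->
  (forall t, 0 <= t <= T -> is_derive_within `[0, T] u t (u' t)) ->
  0 <= s <= T -> 0 <= t <= T ->
  exists tau, [/\ 0 <= tau <= T, `|tau - s| <= `|t - s| &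
    c (u t - u s) = (t - s) * c (u' tau)].
Proof.
move=> cc du.
have du1 z : 0 < z < T -> is_derive z (1 : R) (c \o u : R -> R) (c (u' z)).
  move=> /andP[z0 zT].
  have zT' : 0 <= z <= T by rewrite !ltW.
  have /is_derive_withinP D := is_derive_within_comp_linear cc (du _ zT').
  have lim : h^-1 *: (((c \o u) \o shift z) (h *: (1 : R)) - (c \o u) z : R)
      @[h --> (0 : R)^'] --> (c (u' z) : R).
    apply/cvgrPdist_le => eps eps0.
    have [d d0 dP] := D _ eps0.
    (* Increments below [d1] keep [z + h] inside [0,T], where the relative derivative controls
       [u]. *)
    pose d1 := Num.min d (Num.min z (T - z)).
    have d10 : 0 < d1 by rewrite !lt_min d0 z0 subr_gt0.
    apply/nbhs_normP; exists d1 => //= h; rewrite /= sub0r normrN => hd1 h0.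
    move: hd1; rewrite !lt_min => /andP[hd /andP[hz hTz]].
    have hA : `[0, T]%classic (z + h).
      rewrite /= in_itv/=; move: hz hTz; rewrite !ltr_norml => /andP[? ?] /andP[? ?].
      by apply/andP; split; lra.
    have := dP (z + h) hA; rewrite addrAC subrr add0r => /(_ hd).
    rewrite scaler1 /= [h + z]addrC => H.
    have E (a b v : R) : v - h^-1 * (a - b) = - h^-1 * (a - b - h * v) by field.
    rewrite [X in `|X|](E (c (u (z + h))) (c (u z)) (c (u' z))).
    by rewrite normrM normrN normfV mulrC ler_pdivrMr ?normr_gt0.
  apply: DeriveDef; first by apply/cvg_ex; exists (c (u' z)).
  exact: (cvg_lim (@Rhausdorff R) lim).
have cu : {within `[0, T], continuous (c \o u : R -> R)}.
  apply/(@within_continuousP R^o) => z; rewrite /= in_itv/= => zT eps eps0.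
  have [d d0 dP] := is_derive_within_lipschitz (is_derive_within_comp_linear cc (du _ zT)).
  have l0 : 0 < `|c (u' z)| + 1 by rewrite ltr_wpDl.
  exists (Num.min d (eps / (`|c (u' z)| + 1))); first by rewrite lt_min d0 divr_gt0.
  move=> w wT; rewrite lt_min => /andP[wd we].
  by apply: (le_trans (dP _ wT wd)); rewrite mulrC -ler_pdivlMr// ltW.
have key a b : 0 <= a -> a < b -> b <= T -> exists tau, [/\ a <= tau, tau <= b &
    c (u b - u a) = (b - a) * c (u' tau)].
  move=> a0 ab bT.
  have [z||z zab E] := @MVT R (c \o u) (c \o u') a b ab.
  - rewrite in_itv/= => /andP[az zb]; apply: du1.
    by rewrite (le_lt_trans a0 az) (lt_le_trans zb bT).
  - apply: continuous_subspaceW cu => z /=; rewrite !in_itv/= => /andP[az zb].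
    by rewrite (le_trans a0 az) (le_trans zb bT).
  - move: zab; rewrite in_itv/= => /andP[/ltW az /ltW zb].
    by exists z; split => //; rewrite linearB mulrC -E.
move=> /andP[s0 sT] /andP[t0 tT].
have [st|ts|<-] := ltgtP s t.
- have [z [sz zt E]] := key s t s0 st tT; exists z; split => //.
    by rewrite (le_trans s0 sz) (le_trans zt tT).
  by rewrite ger0_norm ?subr_ge0// ger0_norm ?subr_ge0 ?(ltW st)// lerD2r.
- have [z [tz zs E]] := key t s t0 ts sT; exists z; split => //.
  + by rewrite (le_trans t0 tz) (le_trans zs sT).
  + rewrite distrC [leRHS]distrC ger0_norm ?subr_ge0//.
    by rewrite ger0_norm ?subr_ge0 ?(ltW ts)// lerD2l lerN2.
  + by rewrite -opprB linearN E -mulNr opprB.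
- exists s; split => //; first by rewrite s0 sT.
  by rewrite !subrr mul0r linear0.
Qed.

(** Two uses of mean values: the first makes [x] Lipschitz with constant [L]; the second turns each
    coordinate of the remainder into (t - s) times a coordinate of F(x(tau)) - F(x(s)), which is O(t
    - s) in turn. *)
Lemma derive_within_quadratic V (F : V -> V) (x : R -> V) (T r : R) :
  fin_dim V -> 0 < r ->
  (forall t, 0 <= t <= T -> C11_ball F (x t) r) ->
  (forall t, 0 <= t <= T -> is_derive_within `[0, T] x t (F (x t))) ->
  exists C d, [/\ 0 < C, 0 < d & forall s t, 0 <= s <= T -> 0 <= t <= T ->
    `|t - s| <= d -> `|x t - x s| < r /\
    `|x t - x s - (t - s) *: F (x s)| <= C * (t - s) ^+ 2].
Proof.
move=> [I [e [c ec]]] r0 Fr dx.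
have [B B0 BP] := norm_le_coordinates ec.
have /fin_all_exists[b bP] i : exists b, 0 < b /\ forall v, `|c i v| <= b * `|v|.
  by have [b] := continuous_linear_le (ec.1 i); exists b.
pose M := 1 + \sum_i b i.
have M0 : 0 < M by rewrite ltr_pwDl// sumr_ge0// => i _; have [/ltW] := bP i.
have bM i : b i <= M.
  rewrite /M (bigD1 i)//= addrCA lerDl addr_ge0// sumr_ge0// => j _.
  by have [/ltW] := bP j.
have cM i v : `|c i v| <= M * `|v|.
  by have [_ /(_ v)/le_trans] := bP i; apply; rewrite ler_wpM2r.
pose K := r^-1; have K0 : 0 < K by rewrite invr_gt0.
pose L := B * (M * K).
have L0 : 0 < L by rewrite /L !mulr_gt0.
have FK t : 0 <= t <= T -> `|F (x t)| <= K.
  move=> tT; have tr : `|x t - x t| < r by rewrite subrr normr0.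
  by have [] := Fr _ tT _ _ tr tr.
have lip s t : 0 <= s <= T -> 0 <= t <= T -> `|x t - x s| <= L * `|t - s|.
  move=> sT tT; rewrite /L -mulrA; apply: BP.
    by rewrite !mulr_ge0// ltW.
  move=> i; have [tau [tauT _ ->]] := coordinate_MVT (ec.1 i) dx sT tT.
  rewrite normrM [_ * `|t - s|]mulrC ler_wpM2l//; apply: (le_trans (cM _ _)).
  by rewrite ler_pM2l// FK.
(* For |t - s| at most r/(2L) the intermediate point [x tau] lies in the ball around [x s] on which
   F is controlled. *)
exists (B * (M * (K * L))), (r / (2 * L)); split.
- by rewrite !mulr_gt0.
- by rewrite divr_gt0// mulr_gt0.
move=> s t sT tT std.
have near w : 0 <= w <= T -> `|w - s| <= `|t - s| -> `|x w - x s| < r.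
  move=> wT wst; apply: (le_lt_trans (lip _ _ sT wT)).
  apply: (@le_lt_trans _ _ (L * (r / (2 * L)))).
    by rewrite ler_pM2l// (le_trans wst).
  have -> : L * (r / (2 * L)) = r / 2 by field; rewrite gt_eqF.
  by rewrite ltr_pdivrMr// ltr_pMr// ltr1n.
split; first exact: near.
rewrite -mulrA; apply: BP.
  by apply: mulr_ge0; [rewrite !mulr_ge0// ltW|exact: sqr_ge0].
move=> i; have [tau [tauT taust E]] := coordinate_MVT (ec.1 i) dx sT tT.
rewrite linearB E linearZ/= -[_ *: _]/(_ * _) -mulrBr -linearB normrM.
have -> : M * (K * L) * (t - s) ^+ 2 = `|t - s| * (M * (K * (L * `|t - s|))).
  by rewrite -[(t - s) ^+ 2]real_normK ?num_real//; ring.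
rewrite ler_wpM2l//; apply: (le_trans (cM _ _)); rewrite ler_pM2l//.
have sr : `|x s - x s| < r by rewrite subrr normr0.
have [_ + _ _ _] := Fr _ sT _ _ sr (near _ tauT taust).
move=> /le_trans; apply; rewrite ler_pM2l//.
by apply: (le_trans (lip _ _ sT tauT)); rewrite ler_pM2l.
Qed.

End DerivativeWithin.

(** * From DAE solutions to convergence *)

Section Splitting.
Context {R : realType} {ny1 ny2 nz1 nz2 : nat}.
Context (g1 : dae_state R ny1 ny2 nz1 nz2 -> 'rV[R]_nz1)
        (g2 : dae_state R ny1 ny2 nz1 nz2 -> 'rV[R]_nz2).

Let V := dae_state R ny1 ny2 nz1 nz2.
Let W := 'rV[R]_(nz1 + nz2).

Context (U : set V) (oU : open U).
Context (g1C : of_class_C 3 U g1) (g2C : of_class_C 3 U g2).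
Context (Jreg : forall p, U p -> constraint_jacobian g1 g2 p \in unitmx).

Let con := constraint g1 g2.
Let finV : fin_dim V := fin_dim_dae_state.
Let finW : fin_dim W := fin_dim_rV (nz1 + nz2).

(** Tangency removes the first-order term of the constraint along [u], so its increments are
    quadratic in time and [increment_le] with slope 0 makes it constant. *)
Lemma curve_is_solution (k1 : V -> 'rV[R]_ny1) (k2 : V -> 'rV[R]_ny2)
    (a : V) (r h : R) (u : R -> V) :
  (forall q, `|q - a| < r -> U q) -> C11_ball con a r ->
  C11_ball (lifted_field g1 g2 k1 k2) a r -> 0 < h ->
  quadratic_curve (lifted_field g1 g2 k1 k2) h u ->
  (forall t, 0 <= t <= h -> `|u t - a| < r) ->
  con (u 0) = 0 -> is_solution k1 k2 g1 g2 h (u 0) u.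
Proof.
set F := lifted_field g1 g2 k1 k2.
move=> rU cr Fr h0 uq u_in c0.
have [C C0 CP] := quadratic_curve_pos uq.
pose K := r^-1.
have h00 : 0 <= (0 : R) <= h by rewrite lexx ltW.
have K0 : 0 <= K.
  by have [+ _ _ _ _] := Fr _ _ (u_in _ h00) (u_in _ h00); apply: le_trans.
have lip s t : 0 <= s -> s <= t -> t <= h -> `|u t - u s| <= (C * h + K) * (t - s).
  move=> s0 st th; have sh : 0 <= s <= h by rewrite s0 (le_trans st).
  rewrite -[u t - u s](subrK ((t - s) *: F (u s))).
  apply: (le_trans (ler_normD _ _)); rewrite mulrDl; apply: lerD.
    apply: (le_trans (CP _ _ s0 st th)); rewrite expr2 mulrA ler_wpM2r ?subr_ge0//.
    by rewrite ler_wpM2l// lerBlDr (le_trans th)// lerDl.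
  rewrite normrZ ger0_norm ?subr_ge0// mulrC ler_wpM2r ?subr_ge0//.
  by have [] := Fr _ _ (u_in _ sh) (u_in _ sh).
have conserved t : 0 <= t <= h -> con (u t) = 0.
  move=> /andP[t0 th]; apply/eqP; rewrite -normr_le0 -[con (u t)]subr0 -c0.
  rewrite -[leRHS](mul0r t).
  apply: (@increment_le _ _ (con \o u) t 0 (K * (C * h + K) ^+ 2 + K * C)) => //.
    by apply: addr_ge0; apply: mulr_ge0 => //; exact: sqr_ge0.
  move=> s s' s0 ss' s't; have s'h := le_trans s't th.
  have sh : 0 <= s <= h by rewrite s0 (le_trans ss').
  have sh' : 0 <= s' <= h by rewrite s'h (le_trans s0).
  have [_ _ c3 c4 _] := cr _ _ (u_in _ sh) (u_in _ sh').
  have tang : 'd con (u s) (F (u s)) = 0.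
    by apply: lift_z_tangent oU g1C g2C Jreg _ _ _; apply: rU; exact: u_in.
  have -> : (con \o u) s' - (con \o u) s =
      (con (u s') - con (u s) - 'd con (u s) (u s' - u s)) +
      'd con (u s) (u s' - u s - (s' - s) *: F (u s)).
    rewrite ['d con (u s) (_ - _ *: _)]linearB linearZ /= tang.
    by rewrite scaler0 subr0 subrK.
  apply: (le_trans (ler_normD _ _)); rewrite mul0r add0r mulrDl; apply: lerD.
    apply: (le_trans c3); rewrite -mulrA ler_wpM2l// -exprMn lerXn2r ?nnegrE//.
      by rewrite mulr_ge0 ?subr_ge0// addr_ge0// mulr_ge0// ltW.
    exact: lip.
  apply: (le_trans (c4 _)); rewrite -mulrA ler_wpM2l//; exact: CP.
split => //.
  apply/within_continuousP => t th eps eps0.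
  have /within_continuousP uc := quadratic_curve_continuous uq.
  have [d d0 dP] := uc t th eps eps0; exists d => // s sh st.
  apply: le_trans (dP s sh st).
  by rewrite -[(u s).2 - (u t).2]/((u s - u t).2) [leRHS]prod_normE le_max lexx orbT.
move=> t th.
have du : is_derive_within `[0, h] u t (F (u t)) by apply: quadratic_curve_derive.
have Fy : (F (u t)).1 = (k1 (u t), k2 (u t)) by exact: lifted_field_y.
have [G1 G2] := (constraint_eq0 g1 g2 (u t)).1 (conserved t th).
split => //.
- rewrite -[k1 (u t)]/((k1 (u t), k2 (u t)).1) -Fy.
  apply: (@cvg_comp _ _ _ (fun s => (s - t)^-1 *: (u s - u t)) (fun v : V => v.1.1) _ _ _ du).
  by apply: (@cvg_comp _ _ _ fst fst); [exact: cvg_fst|exact: cvg_fst].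
- rewrite -[k2 (u t)]/((k1 (u t), k2 (u t)).2) -Fy.
  apply: (@cvg_comp _ _ _ (fun s => (s - t)^-1 *: (u s - u t)) (fun v : V => v.1.2) _ _ _ du).
  by apply: (@cvg_comp _ _ _ fst snd); [exact: cvg_fst|exact: cvg_snd].
Qed.

(* The algebraic components of a solution are differentiable although only
   continuity is assumed: the constraint determines the increment of z from
   that of y up to a quadratic error. *)
Lemma solution_derivative (f1 : V -> 'rV[R]_ny1) (f2 : V -> 'rV[R]_ny2)
    (T : R) (x0 : V) (x : R -> V) :
  is_solution f1 f2 g1 g2 T x0 x -> (forall t, 0 <= t <= T -> U (x t)) ->
  forall t, 0 <= t <= T ->
    is_derive_within `[0, T] x t (lifted_field g1 g2 f1 f2 (x t)).
Proof.
move=> [_ zc xsol] xU t tT; have Up := xU t tT.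
set p := x t in Up *.
have [d1 gp1 d2 gp2] := xsol t tT.
have cC : of_class_C 2 U con.
  by apply: of_class_C_le (constraint_of_class_C oU g1C g2C).
have [r r0 cr] : exists2 r : R, 0 < r & forall q, [set p] q -> C11_ball con q r.
  apply: compact_uniform_radius; first exact: compact_set1.
  by move=> _ ->; exact: C11_ball_near cC.
have {}cr := cr p erefl.
pose K := r^-1; have K0 : 0 < K by rewrite invr_gt0.
pose J := constraint_jacobian g1 g2 p.
pose QL : {linear W -> V} := inject_z \o mulmxr (invmx J).
pose Q (w : W) : V := QL w.
have [B B0 BP] := continuous_linear_le (@fin_dim_linear_continuous _ _ _ QL finW).
pose S : {linear V -> V} := lift_z g1 g2 p.
have [D D0 DP] := continuous_linear_le (@fin_dim_linear_continuous _ _ _ S finV).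
have SE v : S v = v - Q ('d con p v) by [].
have con0 s : 0 <= s <= T -> con (x s) = 0.
  by move=> /xsol[_ G1 _ G2]; apply/constraint_eq0.
pose H : V := ((f1 p, f2 p), 0).
pose yp (v : V) : V := (v.1, 0).
have QD (v : V) : Q ('d con p (v - yp v)) = v - yp v.
  have -> : v - yp v = inject_z (row_mx v.2.1 v.2.2).
    rewrite /inject_z row_mxKl row_mxKr -surjective_pairing /yp.
    by congr pair; rewrite /= ?subrr ?subr0.
  rewrite /Q /QL /= -mul_constraint_jacobian; last exact: constraint_differentiable oU g1C g2C _ Up.
  by rewrite mulmxK//; exact: Jreg.
(* Every increment is the lift of its y-part plus a correction by its constraint derivative. Between
   consistent states that derivative is a pure Taylor remainder, so the correction is quadratic. *)
have split_incr (v : V) : v = S (yp v) + Q ('d con p v).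
  have := QD v; rewrite linearB -[Q _]/(QL _) linearB => E.
  rewrite SE -[Q ('d con p v)]/(QL ('d con p v))
    -[Q ('d con p (yp v))]/(QL ('d con p (yp v))).
  by rewrite addrAC -addrA E addrC subrK.
have quad s : 0 <= s <= T -> `|x s - p| < r ->
    `|Q ('d con p (x s - p))| <= B * K * `|x s - p| ^+ 2.
  move=> sT sr; apply: (le_trans (BP _)); rewrite -mulrA ler_pM2l//.
  have pr : `|p - p| < r by rewrite subrr normr0.
  have [_ _ + _ _] := cr _ _ pr sr.
  by rewrite /p !con0// subr0 sub0r normrN.
have /is_derive_withinP D1 := d1; have /is_derive_withinP D2 := d2.
have ydiff eps : 0 < eps -> exists2 d, 0 < d & forall s, `[0, T]%classic s ->
    `|s - t| < d -> `|yp (x s - p) - (s - t) *: H| <= eps * `|s - t|.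
  move=> eps0; have [e1 e10 e1P] := D1 _ eps0; have [e2 e20 e2P] := D2 _ eps0.
  exists (Num.min e1 e2); first by rewrite lt_min e10.
  move=> s sT; rewrite lt_min => /andP[s1 s2].
  have E0 : 0 <= eps * `|s - t| by rewrite mulr_ge0// ltW.
  rewrite !prod_normE !ge_max /= (e1P s sT s1) (e2P s sT s2) /=.
  by rewrite !scaler0 !subr0 !normr0 E0.
have /within_continuousP/(_ t) zcont := zc.
have tA : `[0, T]%classic t by rewrite /= in_itv.
(* Below [rho] the quadratic correction is at most half the increment and is absorbed, which gives
   the Lipschitz constant [L]. Continuity of z is what brings the increment below [rho]. *)
pose rho := Num.min (r / 2) (2 * (B * K))^-1.
have rho0 : 0 < rho by rewrite lt_min divr_gt0// invr_gt0 !mulr_gt0.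
have [dz dz0 dzP] := zcont tA rho rho0.
have [dy dy0 dyP] := ydiff 1 ltr01.
pose L := 2 * D * (`|H| + 1).
have H1 : 0 < `|H| + 1 by rewrite ltr_wpDl.
have L0 : 0 < L by rewrite !mulr_gt0.
have lip : exists2 d, 0 < d & forall s, `[0, T]%classic s -> `|s - t| < d ->
    `|x s - p| < r /\ `|x s - p| <= L * `|s - t|.
  exists (Num.min (Num.min dz dy) (rho / (`|H| + 1))).
    by rewrite !lt_min dz0 dy0 divr_gt0.
  move=> s sT; rewrite !lt_min => /andP[/andP[sz sy] sr].
  have sT' : 0 <= s <= T by move: sT; rewrite /= in_itv.
  have ynorm : `|yp (x s - p)| <= (`|H| + 1) * `|s - t|.
    rewrite -[yp _](subrK ((s - t) *: H)); apply: (le_trans (ler_normD _ _)).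
    by rewrite addrC mulrDl lerD ?dyP// normrZ mulrC.
  have small : `|x s - p| <= rho.
    rewrite prod_normE ge_max (dzP s sT sz) andbT.
    apply: (@le_trans _ _ `|yp (x s - p)|); first by rewrite [leRHS]prod_normE le_max lexx.
    by apply: (le_trans ynorm); rewrite mulrC -ler_pdivlMr// ltW.
  have xsr : `|x s - p| < r.
    apply: (le_lt_trans small); rewrite gt_min; apply/orP; left.
    by rewrite ltr_pdivrMr// ltr_pMr// ltr1n.
  split => //.
  have half : `|Q ('d con p (x s - p))| <= `|x s - p| / 2.
    apply: (le_trans (quad s sT' xsr)); rewrite expr2 mulrA mulrC ler_wpM2l//.
    apply: (@le_trans _ _ (B * K * (2 * (B * K))^-1)).
      by rewrite ler_pM2l ?mulr_gt0// (le_trans small)// ge_min lexx orbT.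
    by rewrite le_eqVlt; apply/orP; left; apply/eqP; field; rewrite !gt_eqF.
  have : `|x s - p| <= D * ((`|H| + 1) * `|s - t|) + `|x s - p| / 2.
    rewrite {1}(split_incr (x s - p)); apply: (le_trans (ler_normD _ _)).
    by rewrite lerD// (le_trans (DP _))// ler_pM2l.
  by rewrite /L; lra.
have [dl dl0 dlP] := lip.
apply/is_derive_withinP => eps eps0.
have [e e0 eP] := ydiff (eps / (2 * D)) (divr_gt0 eps0 (mulr_gt0 (ltr0Sn _ 1) D0)).
pose M := B * K * L ^+ 2; have M0 : 0 < M by rewrite !mulr_gt0// exprn_gt0.
exists (Num.min (Num.min dl e) (eps / (2 * M))).
  by rewrite !lt_min dl0 e0 divr_gt0// mulr_gt0.
move=> s sT; rewrite !lt_min => /andP[/andP[sl se] sm].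
have sT' : 0 <= s <= T by move: sT; rewrite /= in_itv.
have [sr sL] := dlP s sT sl.
have -> : x s - x t - (s - t) *: lifted_field g1 g2 f1 f2 p =
    S (yp (x s - p) - (s - t) *: H) + Q ('d con p (x s - p)).
  have -> : lifted_field g1 g2 f1 f2 p = S H by [].
  have -> : S (yp (x s - p) - (s - t) *: H) = S (yp (x s - p)) - (s - t) *: S H.
    by rewrite linearB; congr (_ - _); rewrite linearZ.
  by rewrite -/p {1}(split_incr (x s - p)) addrAC.
apply: (le_trans (ler_normD _ _)).
have -> : eps * `|s - t| = D * (eps / (2 * D) * `|s - t|) + eps / 2 * `|s - t|.
  by field; rewrite gt_eqF.
apply: lerD; first by apply: (le_trans (DP _)); rewrite ler_pM2l// eP.
apply: (le_trans (quad s sT' sr)).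
apply: (@le_trans _ _ (B * K * (L * `|s - t|) ^+ 2)).
  by rewrite ler_pM2l ?mulr_gt0// lerXn2r// ?nnegrE// mulr_ge0// ltW.
rewrite exprMn mulrA -/M [X in _ * X]expr2 mulrA ler_wpM2r//.
apply: (@le_trans _ _ (M * (eps / (2 * M)))); first by rewrite ler_pM2l// ltW.
by rewrite le_eqVlt; apply/orP; left; apply/eqP; field; rewrite gt_eqF.
Qed.

(** [euler_flow] supplies the exact solution from [q] against which [has_order] is read, and the
    expansion hypothesis on [G] then eliminates this solution from the estimate. *)
Lemma has_order_step_approx (k1 : V -> 'rV[R]_ny1) (k2 : V -> 'rV[R]_ny2)
    (T : R) (x : R -> V) (p m : nat) (Phi G : R -> V -> V) (r CG : R) :
  0 < r -> 0 <= CG ->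
  (forall t, 0 <= t <= T -> forall q, `|q - x t| < r -> U q) ->
  (forall t, 0 <= t <= T -> C11_ball con (x t) r) ->
  (forall t, 0 <= t <= T -> C11_ball (lifted_field g1 g2 k1 k2) (x t) r) ->
  (forall t u h, 0 <= t <= T -> 0 <= h ->
     quadratic_curve (lifted_field g1 g2 k1 k2) h u ->
     (forall s, 0 <= s <= h -> `|u s - x t| < r) ->
     `|u h - G h (u 0)| <= CG * h ^+ m.+1) ->
  (m <= p)%N -> has_order k1 k2 g1 g2 T x p Phi ->
  step_approx (x @` `[0, T]) [set q | con q = 0] G m Phi.
Proof.
move=> r0 CG0 rU cr Fr GP mp [C [h0 [d [C0 h00 d0 ord]]]].
set F := lifted_field g1 g2 k1 k2 in Fr GP *.
pose K := r^-1; have K0 : 0 < K by rewrite invr_gt0.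
(* With K = 1/r, the entries r/2 and r^2/2 give |q - x t| < r/2 and K h <= r/2, the room that
   [euler_flow] asks for; h <= 1 allows lowering the order from [p] to [m]. *)
pose d' := Num.min (Num.min d h0) (Num.min 1 (Num.min (r / 2) (r * r / 2))).
exists (C + K + CG), d'; split.
- by rewrite ltr_wpDr// addr_gt0.
- by rewrite !lt_min d0 h00 ltr01 !divr_gt0// mulr_gt0.
move=> a q h [t] /=; rewrite in_itv/= => tT <- {a} qZ.
rewrite !lt_min => /andP[/andP[qd _] /andP[_ /andP[qr _]]] h_gt0.
rewrite !le_min => /andP[/andP[_ hh0] /andP[h1 /andP[_ hr]]].
have qKr : `|q - x t| + K * h < r.
  rewrite [ltRHS]splitr; apply: ltr_leD => //.
  apply: (@le_trans _ _ (K * (r * r / 2))); first by rewrite ler_pM2l.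
  by rewrite le_eqVlt; apply/orP; left; apply/eqP; rewrite /K; field; rewrite gt_eqF.
have FK z : `|z - x t| < r -> `|F z| <= K.
  by move=> zr; have [] := Fr t tT _ _ zr zr.
have FL z z' : `|z - x t| < r -> `|z' - x t| < r -> `|F z' - F z| <= K * `|z' - z|.
  by move=> zr zr'; have [] := Fr t tT _ _ zr zr'.
have [u [u0 u_in uq]] := euler_flow K0 h_gt0 qKr FK finV FL.
have q0 : con (u 0) = 0 by rewrite u0.
have us := curve_is_solution (rU t tT) (cr t tT) (Fr t tT) h_gt0 uq u_in q0.
rewrite u0 in us.
have [gq1 gq2] := (constraint_eq0 g1 g2 q).1 qZ.
have h0h : 0 < h <= h0 by rewrite h_gt0.
have [P1 P2 /(_ u us) P3] := ord t q h tT qd gq1 gq2 h0h.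
have hm : h ^+ p.+1 <= h ^+ m.+1 by rewrite ler_wiXn2l// ltW.
have {}P3 : `|Phi h q - u h| <= C * h ^+ m.+1.
  by apply: (le_trans P3); rewrite ler_pM2l.
split.
- exact/constraint_eq0.
- have -> : Phi h q - q = (Phi h q - u h) + (u h - u 0) by rewrite u0; lincomb finV.
  apply: (le_trans (ler_normD _ _)).
  apply: (@le_trans _ _ (C * h + K * h)); last first.
    by rewrite -mulrDl ler_pM2r// lerDl.
  apply: lerD.
    apply: (le_trans P3); rewrite ler_pM2l// exprS ler_piMr ?(ltW h_gt0)//.
    by rewrite exprn_ile1 ?(ltW h_gt0).
  exact: (curve_increment finV (Fr t tT) uq u_in (ltW h_gt0) (lexx h)).
- have -> : Phi h q - G h q = (Phi h q - u h) + (u h - G h (u 0)).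
    by rewrite u0; lincomb finV.
  apply: (le_trans (ler_normD _ _)).
  have GE := GP t u h tT (ltW h_gt0) uq u_in.
  apply: (le_trans (lerD P3 GE)); rewrite -mulrDl ler_pM2r ?exprn_gt0//.
  by rewrite addrAC lerDl ltW.
Qed.

(** The expansion hypothesis is stated for all integral curves near the trajectory, so it applies to
    the shifted trajectory s -> x(t + s), an integral curve for short times, and yields the defect
    of the exact solution. *)
Lemma solution_convergent (f1 : V -> 'rV[R]_ny1) (f2 : V -> 'rV[R]_ny2)
    (T : R) (x0 : V) (x : R -> V) (m : nat) (G Psi : R -> V -> V) (r L CG : R) :
  0 < T -> is_solution f1 f2 g1 g2 T x0 x ->
  (forall t, 0 <= t <= T -> U (x t)) -> 0 < r -> 0 <= L -> 0 <= CG ->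
  (forall t, 0 <= t <= T -> C11_ball (lifted_field g1 g2 f1 f2) (x t) r) ->
  (forall t q h, 0 <= t <= T -> `|q - x t| < r -> 0 <= h -> h <= 1 ->
     `|G h q - G h (x t)| <= (1 + L * h) * `|q - x t|) ->
  (forall t u h, 0 <= t <= T -> 0 <= h ->
     quadratic_curve (lifted_field g1 g2 f1 f2) h u ->
     (forall s, 0 <= s <= h -> `|u s - x t| < r) ->
     `|u h - G h (u 0)| <= CG * h ^+ m.+1) ->
  (0 < m)%N ->
  step_approx (x @` `[0, T]) [set q | con q = 0] G m Psi ->
  is_convergent T x0 x m Psi.
Proof.
set F := lifted_field g1 g2 f1 f2.
move=> T0 xsol xU r0 L0 CG0 Fr GL GP m0 PsiG.
have dx := solution_derivative xsol xU.
have [C [d [C0 d0 xq]]] := derive_within_quadratic finV r0 Fr dx.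
have [x00 _ xS] := xsol.
pose d' := Num.min r (Num.min 1 d).
have d'0 : 0 < d' by rewrite !lt_min r0 ltr01.
have xA t : 0 <= t <= T -> (x @` `[0, T]) (x t) by move=> tT; exists t; rewrite //= in_itv.
have x0Z : [set q | con q = 0] (x 0).
  have T00 : 0 <= (0 : R) <= T by rewrite lexx ltW.
  by have [_ G1 _ G2] := xS 0 T00; apply/constraint_eq0.
have GL' a q h : (x @` `[0, T]) a -> `|q - a| < d' -> 0 < h -> h <= d' ->
    `|G h q - G h a| <= (1 + L * h) * `|q - a|.
  move=> [t] /=; rewrite in_itv/= => tT <-; rewrite lt_min => /andP[qr _] h0.
  by rewrite !le_min => /and3P[_ h1 _]; apply: GL => //; exact: ltW.
have xG t h : 0 <= t -> 0 < h -> h <= d' -> t + h <= T ->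
    `|x (t + h) - G h (x t)| <= CG * h ^+ m.+1.
  move=> t0 h0; rewrite !le_min => /and3P[_ _ hd] thT.
  have tT : 0 <= t <= T by rewrite t0 (le_trans _ thT)// lerDl ltW.
  have sT s : 0 <= s <= h -> 0 <= t + s <= T.
    by move=> /andP[s0 sh]; rewrite addr_ge0//= (le_trans _ thT)// lerD2l.
  have xt0 : x t = x (t + 0) by rewrite addr0.
  rewrite xt0; apply: (GP t (fun s => x (t + s))) => //; first exact: ltW.
    exists C => s s' sh sh'.
    have ss' : `|t + s' - (t + s)| <= d.
      apply: le_trans hd; rewrite opprD addrACA subrr add0r ler_norml.
      by move: sh sh' => /andP[? ?] /andP[? ?]; apply/andP; split; lra.
    have [_] := xq _ _ (sT s sh) (sT s' sh') ss'.
    by rewrite opprD addrACA subrr add0r.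
  move=> s sh; have [|//] := xq t (t + s) tT (sT s sh).
  rewrite addrAC subrr add0r; move: sh => /andP[s0 sh].
  by rewrite ger0_norm// (le_trans sh).
have [C' [h0 [C'0 h00 conv]]] :=
  one_step_convergence finV T0 m0 xA x0Z L0 CG0 d'0 GL' xG PsiG.
(* Convergence is stated for the sum of the norms of the y- and z-errors, each of which is at most
   the maximum norm of the pair. *)
exists (2 * C'), h0; split => //; first by rewrite mulr_gt0.
move=> N N0 h hh0 n nN /=; have := conv N N0 hh0 n nN; rewrite x00 -/h => H.
set e := iter n (Psi h) x0 - x (n%:R * h) in H.
have -> : 2 * C' * h ^+ m = C' * h ^+ m + C' * h ^+ m by ring.
apply: lerD; apply: le_trans H.
  by rewrite -[X in `|X|]/(e.1) [leRHS]prod_normE le_max lexx.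
by rewrite -[X in `|X|]/(e.2) [leRHS]prod_normE le_max lexx orbT.
Qed.

End Splitting.

(* MathComp-Analysis.  The leading [exists k] renders "sufficiently
   differentiable". *)
Theorem proposition1 (R : realType) :
  exists k : nat,
  forall (ny1 ny2 nz1 nz2 : nat)
    (f1 : dae_state R ny1 ny2 nz1 nz2 -> 'rV[R]_ny1)
    (f2 : dae_state R ny1 ny2 nz1 nz2 -> 'rV[R]_ny2)
    (g1 : dae_state R ny1 ny2 nz1 nz2 -> 'rV[R]_nz1)
    (g2 : dae_state R ny1 ny2 nz1 nz2 -> 'rV[R]_nz2)
    (T : R)
    (x0 : dae_state R ny1 ny2 nz1 nz2)
    (x : R -> dae_state R ny1 ny2 nz1 nz2)
    (U : set (dae_state R ny1 ny2 nz1 nz2)),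
  0 < T ->
  is_unique_solution f1 f2 g1 g2 T x0 x ->
  open U ->
  (forall t : R, 0 <= t <= T -> U (x t)) ->
  of_class_C k U f1 -> of_class_C k U f2 ->
  of_class_C k U g1 -> of_class_C k U g2 ->
  (forall p, U p -> constraint_jacobian g1 g2 p \in unitmx) ->
  (forall (p1 p2 : nat)
     (Phi1 Phi2 : R -> dae_state R ny1 ny2 nz1 nz2 ->
                  dae_state R ny1 ny2 nz1 nz2),
     (1 <= p1)%N -> (1 <= p2)%N ->
     has_order f1 (fun=> 0) g1 g2 T x p1 Phi1 ->
     has_order (fun=> 0) f2 g1 g2 T x p2 Phi2 ->
     is_convergent T x0 x 1 (lie_trotter Phi1 Phi2)) /\
  (forall (p1 p2 p3 : nat)
     (Phi1 Phi2 Phi3 : R -> dae_state R ny1 ny2 nz1 nz2 ->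
                       dae_state R ny1 ny2 nz1 nz2),
     (2 <= p1)%N -> (2 <= p2)%N -> (2 <= p3)%N ->
     has_order f1 (fun=> 0) g1 g2 T x p1 Phi1 ->
     has_order (fun=> 0) f2 g1 g2 T x p2 Phi2 ->
     has_order f1 (fun=> 0) g1 g2 T x p3 Phi3 ->
     is_convergent T x0 x 2 (strang Phi1 Phi2 Phi3)).
Proof.
(* Class C^2 of the lifted fields gives the local estimates, and forming the Jacobian of g consumes
   one further derivative. *)
exists 3%N => ny1 ny2 nz1 nz2 f1 f2 g1 g2 T x0 x U T0 [xsol _] oU xU f1C f2C g1C g2C Jreg.
pose V := dae_state R ny1 ny2 nz1 nz2.
pose F := lifted_field g1 g2 f1 f2.
pose F1 := lifted_field g1 g2 f1 (fun=> 0).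
pose F2 := lifted_field g1 g2 (fun=> 0) f2.
pose con := constraint g1 g2.
have finV : fin_dim V := fin_dim_dae_state.
have conC : of_class_C 2 U con.
  by apply: of_class_C_le (constraint_of_class_C oU g1C g2C).
have FC := lifted_field_of_class_C oU g1C g2C Jreg (of_class_CS f1C) (of_class_CS f2C).
have F1C := lifted_field_of_class_C oU g1C g2C Jreg (of_class_CS f1C)
  (of_class_C_cst 2 U (0 : 'rV[R]_ny2)).
have F2C := lifted_field_of_class_C oU g1C g2C Jreg
  (of_class_C_cst 2 U (0 : 'rV[R]_ny1)) (of_class_CS f2C).
have FE q : F q = F1 q + F2 q by exact: lifted_fieldD.
have dx := solution_derivative oU g1C g2C Jreg xsol xU.
(* Continuity of the whole state makes x([0,T]) compact, so that one radius serves the open set, the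
   constraint and the three fields at once. *)
have xc : {within `[0, T], continuous x}.
  apply/within_continuousP => t; rewrite /= in_itv/= => tT eps eps0.
  have [d d0 dP] := is_derive_within_lipschitz (dx t tT).
  set l := `|_| + 1 in dP; have l0 : 0 < l by rewrite ltr_wpDl.
  exists (Num.min d (eps / l)); first by rewrite lt_min d0 divr_gt0.
  move=> s sT; rewrite lt_min => /andP[sd se].
  by apply: (le_trans (dP _ sT sd)); rewrite mulrC -ler_pdivlMr// ltW.
have [r r0 rP] : exists2 r : R, 0 < r & forall p, (x @` `[0, T]) p ->
    [/\ forall q, `|q - p| < r -> U q, C11_ball con p r, C11_ball F p r,
        C11_ball F1 p r & C11_ball F2 p r].
  apply: compact_uniform_radius.
    by apply: continuous_compact => //; exact: segment_compact.
  move=> a [t] /=; rewrite in_itv/= => /xU Up <-.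
  have H1 := ball_sub_near oU Up.
  have H2 := C11_ball_near finV (fin_dim_rV _) oU Up conC.
  have H3 := C11_ball_near finV finV oU Up FC.
  have H4 := C11_ball_near finV finV oU Up F1C.
  have H5 := C11_ball_near finV finV oU Up F2C.
  apply: filterS (filterI (filterI H1 H2) (filterI (filterI H3 H4) H5)).
  by move=> -[p r] /= [[h1 h2] [[h3 h4] h5]]; exact: And5 h1 h2 h3 h4 h5.
have rT t : 0 <= t <= T -> [/\ forall q, `|q - x t| < r -> U q, C11_ball con (x t) r,
    C11_ball F (x t) r, C11_ball F1 (x t) r & C11_ball F2 (x t) r].
  by move=> tT; apply: rP; exists t; rewrite //= in_itv.
have rU t (tT : 0 <= t <= T) : forall q, `|q - x t| < r -> U q.
  by have [H _ _ _ _] := rT t tT; exact: H.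
have cr t (tT : 0 <= t <= T) : C11_ball con (x t) r.
  by have [_ H _ _ _] := rT t tT; exact: H.
have Fr t (tT : 0 <= t <= T) : C11_ball F (x t) r.
  by have [_ _ H _ _] := rT t tT; exact: H.
have F1r t (tT : 0 <= t <= T) : C11_ball F1 (x t) r.
  by have [_ _ _ H _] := rT t tT; exact: H.
have F2r t (tT : 0 <= t <= T) : C11_ball F2 (x t) r.
  by have [_ _ _ _ H] := rT t tT; exact: H.
have AF1 a : (x @` `[0, T]) a -> C11_ball F1 a r by move=> /rP[_ _ _ H _]; exact: H.
have AF2 a : (x @` `[0, T]) a -> C11_ball F2 a r by move=> /rP[_ _ _ _ H]; exact: H.
have dFE a q : (x @` `[0, T]) a -> `|q - a| < r ->
    forall v, 'd F q v = 'd F1 q v + 'd F2 q v.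
  move=> /rP[aU _ _ _ _] qa v; have Uq := aU q qa.
  have [dF1 _] := F1C; have [dF2 _] := F2C.
  exact: diff_pointwise_sum FE (dF1 q Uq) (dF2 q Uq) v.
have K0 : 0 <= r^-1 by rewrite invr_ge0 ltW.
have K1 : 0 <= r^-1 ^+ 2 by exact: sqr_ge0.
have K2 : 0 <= 2 * r^-1 ^+ 3 by rewrite mulr_ge0// exprn_ge0.
split=> [p1 p2 Phi1 Phi2 p1_1 p2_1 ord1 ord2|p1 p2 p3 Phi1 Phi2 Phi3 p1_2 p2_2 p3_2 ord1 ord2 ord3].
- have exp1 (F' : V -> V) (F'r : forall t, 0 <= t <= T -> C11_ball F' (x t) r) t u h :
      0 <= t <= T -> 0 <= h -> quadratic_curve F' h u ->
      (forall s, 0 <= s <= h -> `|u s - x t| < r) ->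
      `|u h - taylor1 F' h (u 0)| <= r^-1 ^+ 2 * h ^+ 2.
    by move=> tT h0 uq u_in; exact: (curve_expansion1 finV r0 (F'r t tT) h0 uq u_in).
  have s1 := has_order_step_approx oU g1C g2C Jreg r0 K1 rU cr F1r (exp1 _ F1r) p1_1 ord1.
  have s2 := has_order_step_approx oU g1C g2C Jreg r0 K1 rU cr F2r (exp1 _ F2r) p2_1 ord2.
  have s12 := lie_trotter_approx finV r0 AF1 AF2 FE s1 s2.
  apply: (solution_convergent oU g1C g2C Jreg T0 xsol xU r0 K0 K1 Fr _ (exp1 _ Fr) _ s12) => //.
  by move=> t q h tT qr h0 _; exact: (taylor1_lip finV r0 (Fr t tT) qr h0).
- have exp2 (F' : V -> V) (F'r : forall t, 0 <= t <= T -> C11_ball F' (x t) r) t u h :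
      0 <= t <= T -> 0 <= h -> quadratic_curve F' h u ->
      (forall s, 0 <= s <= h -> `|u s - x t| < r) ->
      `|u h - taylor2 F' h (u 0)| <= 2 * r^-1 ^+ 3 * h ^+ 3.
    by move=> tT h0 uq u_in; exact: (curve_expansion2 finV r0 (F'r t tT) h0 uq u_in).
  have s1 := has_order_step_approx oU g1C g2C Jreg r0 K2 rU cr F1r (exp2 _ F1r) p1_2 ord1.
  have s2 := has_order_step_approx oU g1C g2C Jreg r0 K2 rU cr F2r (exp2 _ F2r) p2_2 ord2.
  have s3 := has_order_step_approx oU g1C g2C Jreg r0 K2 rU cr F1r (exp2 _ F1r) p3_2 ord3.
  have s123 := strang_approx finV r0 AF1 AF2 FE dFE s1 s2 s3.
  apply: (solution_convergent oU g1C g2C Jreg T0 xsol xU r0 (addr_ge0 K0 K1) K2 Fr _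
    (exp2 _ Fr) _ s123) => //.
  by move=> t q h tT qr h0 h1; exact: (taylor2_lip finV r0 (Fr t tT) qr h0 h1).
Qed.
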